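(* Let $\mathfrak M$ be a countable transitive model of ZFC, $\mathbb P\in\mathfrak M$ a forcing notion, and $t\in\mathfrak M$ a $\mathbb P$-name such that $\mathbb P$ forces that $t[G]$ is a subset of $\omega^\omega$. Then the set $W$ of all $y\in\omega^\omega$ such that $R_y=t[G]$ for some set $G\subseteq\mathbb P$ which is $\mathbb P$-generic over $\mathfrak M$, is a Borel subset of $\omega^\omega$.
   Context: For $y\in\omega^\omega$ and $n\in\omega$, $(y)_n\in\omega^\omega$ is defined by $(y)_n(k)=y(2^n(2k+1)-1)$, and $R_y=\{(y)_n:n\in\omega\}\setminus\{(y)_0\}$. (Thus every at most countable subset of $\omega^\omega$, including $\varnothing$, is of the form $R_y$.) $t[G]$ denotes the interpretation of the name $t$ by the generic filter $G$. *)

(* Defs.v *)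
From HB Require Import structures.
From mathcomp Require Import all_boot all_classical.
From mathcomp Require Import topology measurable_structure.

Set Implicit Arguments.
Unset Strict Implicit.
Unset Printing Implicit Defensive.

Local Open Scope classical_set_scope.

(** * Sets

Aczel's type of well-founded trees plays the role of the universe of sets:
[mkEns f] is the set [{f i | i : I}], and equality of sets is the extensional
equality [x ≈ y], not Leibniz equality. *)

Inductive Ens : Type := mkEns (A : Type) (f : A -> Ens).

Definition idx (x : Ens) : Type := match x with mkEns A _ => A end.
Definition elt (x : Ens) : idx x -> Ens :=
  match x return idx x -> Ens with mkEns _ f => f end.

Fixpoint eeq (x y : Ens) : Prop :=
  match x, y with
  | mkEns A f, mkEns B g => (forall i, exists j, eeq (f i) (g j)) /\
                        (forall j, exists i, eeq (f i) (g j))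
  end.
Definition mem (x y : Ens) : Prop := exists i : idx y, eeq x (elt i).

Notation "x ≈ y" := (eeq x y) (at level 70, no associativity).
Notation "x ∈ y" := (mem x y) (at level 70, no associativity).

Definition esub (x y : Ens) : Prop := forall z, z ∈ x -> z ∈ y.
Notation "x ⊆ y" := (esub x y) (at level 70, no associativity).

Definition eempty : Ens := mkEns (fun e : void => of_void Ens e).
Definition upair (x y : Ens) : Ens := mkEns (fun b : bool => if b then x else y).
Definition opair (x y : Ens) : Ens := upair (upair x x) (upair x y).
Definition esucc (x : Ens) : Ens :=
  mkEns (fun o : option (idx x) => if o is Some i then elt i else x).

Fixpoint enat (n : nat) : Ens := if n is k.+1 then esucc (enat k) else eempty.

(** * The language of set theory

Variables are named by natural numbers and [e : nat -> Ens] is an assignment;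
no renaming of bound variables is ever performed, so the abbreviations [FSub],
[FEmpty], [FBaire] and so on choose bound variables larger than their arguments. *)

Inductive fml : Type :=
  | FMem of nat & nat
  | FEq of nat & nat
  | FNot of fml
  | FAnd of fml & fml
  | FAll of nat & fml.

Definition FOr p q := FNot (FAnd (FNot p) (FNot q)).
Definition FImp p q := FNot (FAnd p (FNot q)).
Definition FIff p q := FAnd (FImp p q) (FImp q p).
Definition FEx i p := FNot (FAll i (FNot p)).

Fixpoint free (k : nat) (p : fml) : bool :=
  match p with
  | FMem i j | FEq i j => (k == i) || (k == j)
  | FNot q => free k q
  | FAnd q r => free k q || free k r
  | FAll i q => (k != i) && free k q
  end.

Definition upd (e : nat -> Ens) (i : nat) (x : Ens) : nat -> Ens :=
  fun j => if j == i then x else e j.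

Fixpoint sat (N : Ens) (e : nat -> Ens) (p : fml) : Prop :=
  match p with
  | FMem i j => e i ∈ e j
  | FEq i j => e i ≈ e j
  | FNot q => ~ sat N e q
  | FAnd q r => sat N e q /\ sat N e r
  | FAll i q => forall x, x ∈ N -> sat N (upd e i x) q
  end.

Definition FAllin i j p := FAll i (FImp (FMem i j) p).
Definition FExin i j p := FEx i (FAnd (FMem i j) p).

(* vi is a subset of vj *)
Definition FSub i j := let a := (i + j).+1 in FAllin a i (FMem a j).
(* vi is empty *)
Definition FEmpty i := let a := i.+1 in FAll a (FNot (FMem a i)).
(* vu = {vi, vj} *)
Definition FUpair u i j := let a := (u + i + j).+1 in
  FAll a (FIff (FMem a u) (FOr (FEq a i) (FEq a j))).
(* vu = (vi, vj), the Kuratowski pair *)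
Definition FOpair u i j := let a := (u + i + j).+1 in let b := a.+1 in
  FEx a (FEx b (FAnd (FUpair a i i) (FAnd (FUpair b i j) (FUpair u a b)))).
(* vu = vi union {vi} *)
Definition FSucc u i := let a := (u + i).+1 in
  FAll a (FIff (FMem a u) (FOr (FMem a i) (FEq a i))).
(* vi is an ordinal; well-foundedness comes from the axiom of foundation *)
Definition FOrd i := let a := i.+1 in let b := a.+1 in
  FAnd (FAllin a i (FSub a i))
       (FAllin a i (FAllin b i (FOr (FMem a b) (FOr (FEq a b) (FMem b a))))).
(* vi is a natural number: an ordinal such that it and all its elements are
   zero or successors *)
Definition FNat i := let a := i.+1 in let b := a.+1 in
  FAnd (FOrd i)
       (FAll a (FImp (FOr (FMem a i) (FEq a i))
                     (FOr (FEmpty a) (FEx b (FSucc a b))))).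
(* vi is a function from omega to omega *)
Definition FBaire i := let z := i.+1 in let n := z.+1 in
  let m := n.+1 in let k := m.+1 in
  FAnd (FAllin z i (FEx n (FEx m (FAnd (FNat n) (FAnd (FNat m) (FOpair z n m))))))
       (FAll n (FImp (FNat n)
          (FEx m (FAll k (FIff (FExin z i (FOpair z n k)) (FEq k m)))))).
(* vi is a subset of omega^omega *)
Definition FSubBaire i := let a := i.+1 in FAllin a i (FBaire a).

(** * Models of ZFC *)

Inductive ZFC : fml -> Prop :=
  | ax_extensionality :
      ZFC (FAll 0 (FAll 1
        (FImp (FAll 2 (FIff (FMem 2 0) (FMem 2 1))) (FEq 0 1))))
  | ax_foundation :
      ZFC (FAll 0 (FImp (FEx 1 (FMem 1 0))
        (FExin 1 0 (FNot (FExin 2 0 (FMem 2 1))))))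
  | ax_pairing :
      ZFC (FAll 0 (FAll 1 (FEx 2 (FAnd (FMem 0 2) (FMem 1 2)))))
  | ax_union :
      ZFC (FAll 0 (FEx 1 (FAllin 2 0 (FAllin 3 2 (FMem 3 1)))))
  | ax_power :
      ZFC (FAll 0 (FEx 1 (FAll 2 (FImp (FSub 2 0) (FMem 2 1)))))
  | ax_infinity :
      ZFC (FEx 0 (FAnd (FExin 1 0 (FEmpty 1))
        (FAllin 1 0 (FExin 2 0 (FSucc 2 1)))))
  | ax_choice : (* every disjoint family of nonempty sets has a transversal *)
      ZFC (FAll 0 (FImp
        (FAnd (FAllin 1 0 (FEx 2 (FMem 2 1)))
              (FAllin 1 0 (FAllin 2 0
                 (FImp (FNot (FEq 1 2)) (FNot (FExin 3 1 (FMem 3 2)))))))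
        (FEx 4 (FAllin 1 0 (FEx 2
           (FAll 3 (FIff (FAnd (FMem 3 1) (FMem 3 4)) (FEq 3 2))))))))
  | ax_separation p of ~~ free 1 p :
      ZFC (FAll 2 (FEx 1 (FAll 0 (FIff (FMem 0 1) (FAnd (FMem 0 2) p)))))
  | ax_replacement p of ~~ free 3 p & ~~ free 4 p :
      ZFC (FAll 2 (FImp
        (FAllin 0 2 (FEx 4 (FAll 1 (FIff p (FEq 1 4)))))
        (FEx 3 (FAllin 0 2 (FExin 1 3 p))))).

(* The free variables of the schemata are parameters, ranging over N. *)
Definition models (N : Ens) (T : fml -> Prop) : Prop :=
  (exists x, x ∈ N) /\
  forall p, T p -> forall e, (forall i, e i ∈ N) -> sat N e p.

Definition transitive_set (N : Ens) : Prop := forall x, x ∈ N -> x ⊆ N.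
Definition countable_set (N : Ens) : Prop :=
  exists s : nat -> Ens, forall x, x ∈ N -> exists n, x ≈ s n.

Definition ctm (M : Ens) : Prop :=
  [/\ countable_set M, transitive_set M & models M ZFC].

(** * Forcing

[le] is a set of ordered pairs, and [opair p q ∈ le] means that [p] is stronger
than [q]. *)

Definition forcing_notion (P le : Ens) : Prop :=
  [/\ exists p, p ∈ P,
      forall z, z ∈ le -> exists p q, [/\ p ∈ P, q ∈ P & z ≈ opair p q],
      forall p, p ∈ P -> opair p p ∈ le
    & forall p q r, opair p q ∈ le -> opair q r ∈ le -> opair p r ∈ le].

Definition filter_in (P le G : Ens) : Prop :=
  [/\ G ⊆ P,
      exists p, p ∈ G,
      forall p q, p ∈ G -> q ∈ P -> opair p q ∈ le -> q ∈ G
    & forall p q, p ∈ G -> q ∈ G ->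
        exists r, [/\ r ∈ G, opair r p ∈ le & opair r q ∈ le]].

Definition dense_in (P le D : Ens) : Prop :=
  D ⊆ P /\ forall p, p ∈ P -> exists q, q ∈ D /\ opair q p ∈ le.

Definition generic (M P le G : Ens) : Prop :=
  filter_in P le G /\
  forall D, D ∈ M -> dense_in P le D -> exists p, p ∈ G /\ p ∈ D.

Inductive is_name (P : Ens) : Ens -> Prop :=
  IsName t of
      (forall z, z ∈ t -> exists s p, z ≈ opair s p)
    & (forall s p, opair s p ∈ t -> p ∈ P)
    & (forall s p, opair s p ∈ t -> is_name P s) : is_name P t.

(* [interp G t] is t[G] = {s[G] | (s, p) ∈ t for some p ∈ G}. The recursion is
   structural because s is an element of an element of the pair (s, p);
   see [interp_spec]. *)
Fixpoint interp (G t : Ens) {struct t} : Ens :=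
  match t with
  | mkEns A f =>
      mkEns (fun c : {a : {i : A & {j : idx (f i) & idx (elt j)}} |
                    exists p, p ∈ G /\ f (projT1 a) ≈
                      opair (elt (projT2 (projT2 a))) p} =>
             interp G (elt (projT2 (projT2 (sval c)))))
  end.

(* M[G] *)
Definition ext (M P G : Ens) : Ens :=
  mkEns (fun i : {i : idx M | is_name P (elt i)} => interp G (elt (sval i))).

Definition forces (M P le p : Ens) (phi : fml) (e : nat -> Ens) : Prop :=
  forall G, generic M P le G -> p ∈ G ->
    sat (ext M P G) (fun i => interp G (e i)) phi.

(** * The Baire space *)

Definition baire : Type := prod_topology (fun _ : nat => nat).
HB.instance Definition _ := Pointed.on baire.
HB.instance Definition _ := Nbhs.on baire.
HB.instance Definition _ := Topological.on baire.
HB.instance Definition _ := Uniform.on baire.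

Definition Borel (A : set baire) : Prop := <<s @open baire >> A.

Definition row (y : baire) (n : nat) : baire :=
  fun k => y (2 ^ n * (2 * k + 1) - 1).
Definition Rset (y : baire) : set baire := range (row y) `\ row y 0.

(* The graph of x, as a set of ordered pairs of von Neumann numerals. *)
Definition ens_of_fun (x : baire) : Ens :=
  mkEns (fun n : nat => opair (enat n) (enat (x n))).
Definition ens_of_set (A : set baire) : Ens :=
  mkEns (fun x : {x : baire | A x} => ens_of_fun (sval x)).

(** * The defining property of [interp] *)

Lemma eeq_refl x : x ≈ x.
Proof. by elim: x => I f IH /=; split=> i; exists i. Qed.

Lemma eeq_sym x y : x ≈ y -> y ≈ x.
Proof.
elim: x y => I f IH [J g] /= [h1 h2]; split.
  by move=> j; have [i h] := h2 j; exists i; exact: IH.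
by move=> i; have [j h] := h1 i; exists j; exact: IH.
Qed.

Lemma eeq_trans y x z : x ≈ y -> y ≈ z -> x ≈ z.
Proof.
elim: x y z => I f IH [J g] [K h] /= [a1 a2] [b1 b2]; split.
  move=> i; have [j ij] := a1 i; have [k jk] := b1 j.
  by exists k; exact: IH ij jk.
move=> k; have [j jk] := b2 k; have [i ij] := a2 j.
by exists i; exact: IH ij jk.
Qed.

Lemma mem_elt x (i : idx x) : elt i ∈ x.
Proof. by exists i; exact: eeq_refl. Qed.

Lemma mem_eeql x y z : x ≈ y -> y ∈ z -> x ∈ z.
Proof. by move=> xy [i yi]; exists i; exact: eeq_trans xy yi. Qed.

Lemma mem_eeqr x y z : y ≈ z -> x ∈ y -> x ∈ z.
Proof.
case: y z => I f [J g] [yz _] [i /= xi]; have [j ij] := yz i.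
by exists j; exact: eeq_trans xi ij.
Qed.

Lemma eeqP x y : x ≈ y <-> forall z, z ∈ x <-> z ∈ y.
Proof.
split=> [xy z|].
  by split; apply: mem_eeqr => //; exact: eeq_sym.
case: x y => I f [J g] h; split.
  by move=> i; have /h [j ij] := @mem_elt (mkEns f) i; exists j.
move=> j; have /h [i ij] := @mem_elt (mkEns g) j.
by exists i; exact: eeq_sym.
Qed.

Lemma upair_eeq x x' y y' : x ≈ x' -> y ≈ y' -> upair x y ≈ upair x' y'.
Proof. by move=> ? ?; split=> -[]; [exists true|exists false|exists true|exists false]. Qed.

Lemma opair_eeql x x' y : x ≈ x' -> opair x y ≈ opair x' y.
Proof.
by move=> ?; apply: upair_eeq; apply: upair_eeq => //; exact: eeq_refl.
Qed.

Lemma interp_eeq G s t : s ≈ t -> interp G s ≈ interp G t.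
Proof.
suff H : forall x s t, s ∈ x -> s ≈ t -> interp G s ⊆ interp G t.
  move=> st; apply/eeqP => z; split.
    by apply: (H (upair s s)) => //; exact: (@mem_elt (upair s s) true).
  by apply: (H (upair t t)); [exact: (@mem_elt (upair t t) true)|exact: eeq_sym].
have K u : forall t, u ≈ t -> interp G u ⊆ interp G t /\ interp G t ⊆ interp G u.
  pose Q v := forall t, v ≈ t -> interp G v ⊆ interp G t /\ interp G t ⊆ interp G v.
  suff : Q u /\ (forall i, Q (@elt u i)) /\ (forall i j, Q (@elt (@elt u i) j)).
    by case.
  elim: u => I f IH.
  have Q2 i j : Q (@elt (f i) j) by exact: (IH i).2.1.
  split; last by split => [i|i j]; [exact: (IH i).1|exact: Q2].
  move=> [J g] [fg gf]; split.
  - move=> z [[[i [j k]] [p [pG ep]]] /= zv].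
    have [i' ii'] := fg i.
    have /(mem_eeqr ii') [j' jj'] := @mem_elt (f i) j.
    have /(mem_eeqr jj') [k' kk'] := @mem_elt (elt j) k.
    have c : exists p, p ∈ G /\ g i' ≈ opair (elt k') p.
      exists p; split=> //; apply: eeq_trans (eeq_sym ii') _.
      by apply: eeq_trans ep _; exact: opair_eeql.
    exists (exist _ (existT _ i' (existT _ j' k')) c) => /=.
    apply: eeq_trans zv _; apply/eeqP => w.
    have [a b] := (IH i).2.2 j k _ kk'.
    by split; [exact: a|exact: b].
  - move=> z [[[i [j k]] [p [pG ep]]] /= zv].
    have [i' ii'] := gf i.
    have /(mem_eeqr (eeq_sym ii')) [j' jj'] := @mem_elt (g i) j.
    have /(mem_eeqr jj') [k' kk'] := @mem_elt (elt j) k.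
    have c : exists p, p ∈ G /\ f i' ≈ opair (elt k') p.
      exists p; split=> //; apply: eeq_trans ii' _.
      by apply: eeq_trans ep _; exact: opair_eeql.
    exists (exist _ (existT _ i' (existT _ j' k')) c) => /=.
    apply: eeq_trans zv _; apply/eeqP => w.
    have [a b] := (IH i').2.2 j' k' _ (eeq_sym kk').
    by split; [exact: b|exact: a].
by move=> _ {}s {}t _ /K[].
Qed.

Lemma interp_spec G t z :
  z ∈ interp G t <-> exists s p, [/\ p ∈ G, opair s p ∈ t & z ≈ interp G s].
Proof.
case: t => I f; split.
  move=> [[[i [j k]] [p [pG ep]]] zv]; exists (elt k), p; split=> //.
  by exists i; exact: eeq_sym.
move=> [s [p [pG [i pi] zs]]].
have /(mem_eeqr pi) [j js] : upair s s ∈ opair s p.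
  exact: (@mem_elt (opair s p) true).
have /(mem_eeqr js) [k ks] : s ∈ upair s s by exact: (@mem_elt (upair s s) true).
have c : exists p, p ∈ G /\ f i ≈ opair (elt k) p.
  exists p; split=> //; apply: eeq_trans (eeq_sym pi) _; exact: opair_eeql.
exists (exist _ (existT _ i (existT _ j k)) c) => /=.
by apply: eeq_trans zs _; exact: interp_eeq.
Qed.

(* Main.v *)
(** Back and forth between t[G] and R_y. A state consists of a condition p and of
finitely many requirements s[G] = v, where s is a name and v belongs to the
transitive closure of R_y. A state is killed if, for some dense set of M, for some
element of s that p puts into s[G], or for some element of v, every way of meeting
that set or matching that element leads to a state killed earlier. Stages are indexed
by elements a of M, and being killed at stage a is Borel in y, by ∈-induction on a,
since M is countable.

A state that is true for a generic G is never killed. Conversely, if at some stage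
nothing new is killed, then a surviving state can be extended step by step to a
generic G satisfying its requirements, by ∈-induction on v. What remains is to find one
stage A in M that works for all y in W. If R_y = t[G], then a state is killed at stage a
iff this is forced by some r in G, in a sense given by an inductive definition inside M;
by replacement in M its stages stabilize at an ordinal A of M that does not depend on y
or G. So y is in W iff the killing stabilizes at A and the state with the single
requirement t[G] = R_y survives for some p: a Borel condition. *)

Require Import Defs.
From HB Require Import structures.
From mathcomp Require Import all_boot all_classical.
From mathcomp Require Import topology measurable_structure.

Set Implicit Arguments.
Unset Strict Implicit.
Unset Printing Implicit Defensive.

Local Open Scope classical_set_scope.

(** * Congruence of membership, ∈-induction and ordered pairs *)

Lemma eeq_meml x y z : x ≈ y -> (x ∈ z <-> y ∈ z).
Proof. by move=> xy; split; apply: mem_eeql => //; exact: eeq_sym. Qed.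

Lemma eeq_memr x y z : x ≈ y -> (z ∈ x <-> z ∈ y).
Proof. by move=> xy; split; apply: mem_eeqr => //; exact: eeq_sym. Qed.

Lemma eeq_congr x x' y y' : x ≈ x' -> y ≈ y' -> (x ≈ y <-> x' ≈ y').
Proof.
move=> h k; split=> l.
  exact: eeq_trans (eeq_sym h) (eeq_trans l k).
exact: eeq_trans h (eeq_trans l (eeq_sym k)).
Qed.

Lemma mem_congr x x' y y' : x ≈ x' -> y ≈ y' -> (x ∈ y <-> x' ∈ y').
Proof. by move=> /eeq_meml h /eeq_memr k; rewrite h k. Qed.

(** Elements of [x] are only extensionally equal to its components, so the structural induction is
    on the claim for all [y ≈ x]. *)
Lemma mem_ind (Q : Ens -> Prop) :
  (forall x, (forall y, y ∈ x -> Q y) -> Q x) -> forall x, Q x.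
Proof.
move=> step x; suff H : forall y, y ≈ x -> Q y by exact: H (eeq_refl x).
elim: x => I f IH y yf; apply: step => z /(mem_eeqr yf)[i zi]; exact: IH zi.
Qed.

Lemma mem_upair z x y : z ∈ upair x y <-> z ≈ x \/ z ≈ y.
Proof.
by split=> [[[] ?]|[?|?]]; [left|right|exists true|exists false].
Qed.

Lemma upair_inj1 x y : upair x x ≈ upair y y -> x ≈ y.
Proof.
move=> /eeqP/(_ x)[h _].
have /mem_upair[] // : x ∈ upair y y.
by apply: h; apply/mem_upair; left; exact: eeq_refl.
Qed.

Lemma opair_eeq x x' y y' : x ≈ x' -> y ≈ y' -> opair x y ≈ opair x' y'.
Proof. by move=> ? ?; do 2!apply: upair_eeq => //. Qed.

Lemma opair_inj x y x' y' : opair x y ≈ opair x' y' -> x ≈ x' /\ y ≈ y'.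
Proof.
move=> /eeqP h.
have xx' : x ≈ x'.
  have /mem_upair[/upair_inj1//|/eeqP k] : upair x x ∈ opair x' y'.
    by apply/h/mem_upair; left; exact: eeq_refl.
  have /mem_upair : x' ∈ upair x x by apply/k/mem_upair; left; exact: eeq_refl.
  by case; exact: eeq_sym.
split=> //.
have /mem_upair[/eeqP k|/eeqP k] : upair x y ∈ opair x' y'.
  by apply/h/mem_upair; right; exact: eeq_refl.
- have yx : y ≈ x'.
    have /mem_upair : y ∈ upair x' x' by apply/k/mem_upair; right; exact: eeq_refl.
    by case.
  have /mem_upair[/eeqP l|/eeqP l] : upair x' y' ∈ opair x y.
    by apply/h/mem_upair; right; exact: eeq_refl.
  + have /mem_upair : y' ∈ upair x x by apply/l/mem_upair; right; exact: eeq_refl.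
    move=> y'x; apply: eeq_trans yx _; apply: eeq_trans (eeq_sym xx') _.
    by apply: eeq_sym; case: y'x.
  + have /mem_upair : y' ∈ upair x y by apply/l/mem_upair; right; exact: eeq_refl.
    case=> /eeq_sym // y'x.
    exact: eeq_trans yx (eeq_trans (eeq_sym xx') y'x).
- have /mem_upair[yx|//] : y ∈ upair x' y'.
    by apply/k/mem_upair; right; exact: eeq_refl.
  have /mem_upair[y'x|/eeq_sym//] : y' ∈ upair x y.
    by apply/k/mem_upair; right; exact: eeq_refl.
  exact: eeq_trans yx (eeq_trans (eeq_sym xx') (eeq_sym y'x)).
Qed.

Definition addel (x y : Ens) : Ens :=
  mkEns (fun o : option (idx x) => if o is Some i then elt i else y).

Lemma mem_addel z x y : z ∈ addel x y <-> z ∈ x \/ z ≈ y.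
Proof.
split=> [[[i|] ?]|[[i ?]|?]]; first by left; exists i.
- by right.
- by exists (Some i).
- by exists None.
Qed.

(** * Free variables and renaming in formulas *)

Fixpoint fbound (p : fml) : nat :=
  match p with
  | FMem i j | FEq i j => (i + j).+1
  | FNot q => fbound q
  | FAnd q r => fbound q + fbound r
  | FAll i q => fbound q
  end.

Lemma free_lt_fbound k p : free k p -> k < fbound p.
Proof.
elim: p => [i j|i j|q IH|q IHq r IHr|i q IH] //=.
- by case/orP => /eqP ->; rewrite ltnS ?leq_addr ?leq_addl.
- by case/orP => /eqP ->; rewrite ltnS ?leq_addr ?leq_addl.
- case/orP => [/IHq h|/IHr h]; apply: leq_trans h _; first exact: leq_addr.
  exact: leq_addl.
- by case/andP => _ /IH.
Qed.

Lemma sat_eeq N p e e' : (forall k, free k p -> e k ≈ e' k) ->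
  (sat N e p <-> sat N e' p).
Proof.
elim: p e e' => [i j|i j|q IH|q IHq r IHr|i q IH] e e' /= ee.
- by apply: mem_congr; apply: ee; rewrite eqxx ?orbT.
- by apply: eeq_congr; apply: ee; rewrite eqxx ?orbT.
- by have := IH _ _ ee; tauto.
- have h : sat N e q <-> sat N e' q by apply: IHq => k fk; apply: ee; rewrite fk.
  have k : sat N e r <-> sat N e' r.
    by apply: IHr => k fk; apply: ee; rewrite fk orbT.
  by rewrite h k.
- suff H x : sat N (upd e i x) q <-> sat N (upd e' i x) q.
    by split=> h x xN; apply/H; exact: h.
  apply: IH => k fk; rewrite /upd; case: eqP => [_|/eqP ki]; first exact: eeq_refl.
  by apply: ee; rewrite ki.
Qed.

(** The control of the free variables yields the side conditions of the separation and replacement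
    schemata. *)
Lemma sat_rename p (pi : nat -> nat) : exists q,
  (forall N e, sat N e q <-> sat N (fun n => e (pi n)) p) /\
  (forall k, free k q -> exists i, k = pi i).
Proof.
elim: p pi => [i j|i j|q IH|q IHq r IHr|i q IH] pi.
- by exists (FMem (pi i) (pi j)); split=> //= k /orP[] /eqP ->;
    [exists i|exists j].
- by exists (FEq (pi i) (pi j)); split=> //= k /orP[] /eqP ->;
    [exists i|exists j].
- by have [q' [h1 h2]] := IH pi; exists (FNot q'); split=> // N e /=; rewrite h1.
- have [q' [h1 h2]] := IHq pi; have [r' [h3 h4]] := IHr pi.
  exists (FAnd q' r'); split=> [N e|k] /=; first by rewrite h1 h3.
  by case/orP => [/h2|/h4].
(* [j] exceeds [pi k] for every [k] that can be free in the body, so the new bound variable captures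
   nothing. *)
- pose j := (\max_(k < fbound q) pi k).+1.
  have [q' [h1 h2]] := IH (fun k => if k == i then j else pi k).
  exists (FAll j q'); split=> [N e|k] /=.
    suff H x : sat N (upd e j x) q' <-> sat N (upd (fun n => e (pi n)) i x) q.
      by split=> h x xN; apply/H; exact: h.
    rewrite h1; apply: sat_eeq => k /free_lt_fbound kq; rewrite /upd.
    case: (eqVneq k i) => ki; first by rewrite eqxx; exact: eeq_refl.
    rewrite ifN; first exact: eeq_refl.
    rewrite neq_ltn; apply/orP; left; rewrite ltnS.
    exact: (leq_bigmax (Ordinal kq)).
  case/andP=> kj /h2[l]; case: eqP => _ kl; last by exists l.
  by rewrite kl eqxx in kj.
Qed.

(** * Definability over a model *)

Section Definability.
Context (M : Ens) (c : nat -> Ens).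

Definition env_in (e : nat -> Ens) := forall i, e i ∈ M.

(* Variable 0 is kept free for a quantifier; variables 2n+1 hold the arguments
   and variables 2n+2 the parameters. *)
Definition mix (e : nat -> Ens) (i : nat) : Ens :=
  if i is k.+1 then (if odd k then c k./2 else e k./2) else c 0.

(** Definability with parameters: once [c] lists [M], each element of [M] is the value of some
    even-numbered variable. *)
Definition dfn (Q : (nat -> Ens) -> Prop) : Prop :=
  exists p, forall e, env_in e -> (Q e <-> sat M (mix e) p).

(** A term is definable through its graph: argument 0 is the value, the other arguments are shifted
    by one. *)
Definition tdfn (X : (nat -> Ens) -> Ens) : Prop :=
  (forall e, env_in e -> X e ∈ M) /\ dfn (fun e => e 0 ≈ X (fun n => e n.+1)).

Definition scons (x : Ens) (e : nat -> Ens) : nat -> Ens :=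
  fun n => if n is k.+1 then e k else x.

Lemma scons_in x e : x ∈ M -> env_in e -> env_in (scons x e).
Proof. by move=> xM eM [|n] //=. Qed.

Hypothesis cM : forall n, c n ∈ M.
Hypothesis cS : forall x, x ∈ M -> exists n, x ≈ c n.

Lemma dfn_ext Q Q' : (forall e, env_in e -> (Q e <-> Q' e)) -> dfn Q' -> dfn Q.
Proof. by move=> QQ' [p h]; exists p => e eM; rewrite QQ' // h. Qed.

Lemma dfn_not Q : dfn Q -> dfn (fun e => ~ Q e).
Proof. by case=> p h; exists (FNot p) => e eM /=; rewrite h. Qed.

Lemma dfn_and Q R : dfn Q -> dfn R -> dfn (fun e => Q e /\ R e).
Proof. by case=> p h [q k]; exists (FAnd p q) => e eM /=; rewrite h // k. Qed.

Lemma dfn_or Q R : dfn Q -> dfn R -> dfn (fun e => Q e \/ R e).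
Proof.
move=> dQ dR; apply: (@dfn_ext _ (fun e => ~ (~ Q e /\ ~ R e))).
  move=> e _; split=> [[?|?] []//|h].
  by case: (pselect (Q e)) => [|nQ]; [left|right; apply: contrapT => nR; exact: h].
by apply: dfn_not; apply: dfn_and; exact: dfn_not.
Qed.

Lemma dfn_imp Q R : dfn Q -> dfn R -> dfn (fun e => Q e -> R e).
Proof.
move=> dQ dR; apply: (@dfn_ext _ (fun e => ~ Q e \/ R e)).
  move=> e _; split=> [h|[]//].
  by case: (pselect (Q e)) => [/h|]; [right|left].
by apply: dfn_or => //; exact: dfn_not.
Qed.

Lemma dfn_rename Q (pi : nat -> nat) :
  dfn Q -> dfn (fun e => Q (fun n => e (pi n))).
Proof.
move=> [p h].
pose s i := if i is k.+1 then (if odd k then i else (pi k./2).*2.+1) else 0.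
have [q [h1 _]] := sat_rename p s; exists q => e eM.
rewrite h1 h; last by move=> i; exact: eM.
apply: sat_eeq => -[|k] _ /=; first exact: eeq_refl.
by case: ifP => ok /=; rewrite ?ok ?odd_double ?doubleK; exact: eeq_refl.
Qed.

Lemma dfn_all (Q : Ens -> (nat -> Ens) -> Prop) :
  dfn (fun e => Q (e 0) (fun n => e n.+1)) ->
  dfn (fun e => forall x, x ∈ M -> Q x e).
Proof.
move=> [p h].
(* [s] moves the argument [e 0] from variable 1 to the quantified variable 0, and variable 2n+3 to
   2n+1. Variable 0 may go to 2, since [mix] gives both the value [c 0]. *)
pose s i := if i is k.+1 then
  (if odd k then i else if k is m.+2 then m.+1 else 0) else 2.
have [q [h1 _]] := sat_rename p s; exists (FAll 0 q) => e eM /=.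
suff H x : x ∈ M -> (Q x e <-> sat M (upd (mix e) 0 x) q).
  by split=> k x xM; apply/H => //; exact: k.
move=> xM; have := h _ (scons_in xM eM); rewrite /= => ->.
rewrite h1; apply: sat_eeq => -[|k] _; first exact: eeq_refl.
rewrite /s; case: ifP => ok.
  by rewrite /upd /= ok; exact: eeq_refl.
case: k ok => [|[|k]] //; first by move=> _; exact: eeq_refl.
by rewrite /upd /= negbK => ->; exact: eeq_refl.
Qed.

Lemma dfn_ex (Q : Ens -> (nat -> Ens) -> Prop) :
  dfn (fun e => Q (e 0) (fun n => e n.+1)) ->
  dfn (fun e => exists x, x ∈ M /\ Q x e).
Proof.
move=> dQ; apply: (@dfn_ext _ (fun e => ~ forall x, x ∈ M -> ~ Q x e)).
  move=> e _; split=> [[x [xM Qx]] /(_ x xM)//|h].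
  by apply: contrapT => k; apply: h => x xM Qx; apply: k; exists x.
by apply: dfn_not; apply: dfn_all; exact: dfn_not.
Qed.

Lemma tdfn_var k : tdfn (fun e => e k).
Proof.
split=> [e|]; first exact.
exists (FEq 1 k.+1.*2.+1) => e eM.
by rewrite /sat [mix e _.*2.+1]/mix odd_double doubleK.
Qed.

Lemma tdfn_const d : d ∈ M -> tdfn (fun _ => d).
Proof.
move=> dM; split=> //; have [n dn] := cS dM.
exists (FEq 1 n.*2.+2) => e eM.
rewrite /sat [mix e _.*2.+2]/mix /= odd_double /= uphalf_double.
by apply: eeq_congr => //; exact: eeq_refl.
Qed.

Lemma tdfn_rename X (pi : nat -> nat) :
  tdfn X -> tdfn (fun e => X (fun n => e (pi n))).
Proof.
move=> [XM dX]; split=> [e eM|]; first by apply: XM => i; exact: eM.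
exact: (dfn_rename (fun n => if n is k.+1 then (pi k).+1 else 0) dX).
Qed.

(** Atomic formulas admit only variables, so each term is replaced by a quantified variable equal to
    it. *)
Lemma dfn_atom (R : Ens -> Ens -> Prop) X Y :
  (forall x x' y y', x ≈ x' -> y ≈ y' -> R x y -> R x' y') ->
  dfn (fun e => R (e 1) (e 0)) ->
  tdfn X -> tdfn Y -> dfn (fun e => R (X e) (Y e)).
Proof.
move=> Rc dR [XM dX] [YM dY].
apply: (@dfn_ext _ (fun e => exists x, x ∈ M /\ (x ≈ X e /\
    exists y, y ∈ M /\ (y ≈ Y e /\ R x y)))).
  move=> e eM; split=> [h|[x [_ [xX [y [_ [yY h]]]]]]]; last exact: Rc h.
  exists (X e); split; first exact: XM.
  split; first exact: eeq_refl.
  exists (Y e); split; first exact: YM.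
  by split; first exact: eeq_refl.
apply: dfn_ex; apply: dfn_and => //.
apply: dfn_ex; apply: dfn_and.
  exact: (dfn_rename (fun n => if n is k.+1 then k.+2 else 0) dY).
exact: (dfn_rename (fun n => if n is 0 then 0 else 1) dR).
Qed.

Lemma dfn_mem X Y : tdfn X -> tdfn Y -> dfn (fun e => X e ∈ Y e).
Proof.
apply: dfn_atom; first by move=> x x' y y' xx' yy'; rewrite (mem_congr xx' yy').
by exists (FMem 3 1).
Qed.

Lemma dfn_eeq X Y : tdfn X -> tdfn Y -> dfn (fun e => X e ≈ Y e).
Proof.
apply: dfn_atom; first by move=> x x' y y' xx' yy'; rewrite (eeq_congr xx' yy').
by exists (FEq 3 1).
Qed.

Hypothesis Mtr : transitive_set M.

Lemma eeqMP x y : x ∈ M -> y ∈ M ->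
  (x ≈ y <-> forall z, z ∈ M -> (z ∈ x -> z ∈ y) /\ (z ∈ y -> z ∈ x)).
Proof.
move=> xM yM; split=> [/eeqP h z _|h]; first by split=> ?; apply/h.
apply/eeqP => z; split=> hz.
  by have [] := h z (Mtr xM hz); auto.
by have [] := h z (Mtr yM hz); auto.
Qed.

Hypothesis M_pair : forall x y, x ∈ M -> y ∈ M -> upair x y ∈ M.

Lemma tdfn_upair X Y : tdfn X -> tdfn Y -> tdfn (fun e => upair (X e) (Y e)).
Proof.
move=> dX dY; split=> [e eM|].
  by apply: M_pair; [exact: dX.1|exact: dY.1].
apply: (@dfn_ext _ (fun e => forall z, z ∈ M ->
  (z ∈ e 0 -> z ≈ X (fun n => e n.+1) \/ z ≈ Y (fun n => e n.+1)) /\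
  (z ≈ X (fun n => e n.+1) \/ z ≈ Y (fun n => e n.+1) -> z ∈ e 0))).
  move=> e eM; rewrite eeqMP //; last first.
    by apply: M_pair; [apply: dX.1|apply: dY.1] => i; exact: eM.
  by split=> h z /h; rewrite mem_upair.
have tX := tdfn_rename (fun n => n.+2) dX.
have tY := tdfn_rename (fun n => n.+2) dY.
apply: dfn_all; apply: dfn_and; apply: dfn_imp.
- by apply: dfn_mem; exact: tdfn_var.
- by apply: dfn_or; apply: dfn_eeq => //; exact: tdfn_var.
- by apply: dfn_or; apply: dfn_eeq => //; exact: tdfn_var.
- by apply: dfn_mem; exact: tdfn_var.
Qed.

Lemma tdfn_opair X Y : tdfn X -> tdfn Y -> tdfn (fun e => opair (X e) (Y e)).
Proof. by move=> ? ?; do 2!apply: tdfn_upair => //. Qed.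

Hypothesis M_addel : forall x y, x ∈ M -> y ∈ M -> addel x y ∈ M.

Lemma tdfn_addel X Y : tdfn X -> tdfn Y -> tdfn (fun e => addel (X e) (Y e)).
Proof.
move=> dX dY; split=> [e eM|].
  by apply: M_addel; [exact: dX.1|exact: dY.1].
apply: (@dfn_ext _ (fun e => forall z, z ∈ M ->
  (z ∈ e 0 -> z ∈ X (fun n => e n.+1) \/ z ≈ Y (fun n => e n.+1)) /\
  (z ∈ X (fun n => e n.+1) \/ z ≈ Y (fun n => e n.+1) -> z ∈ e 0))).
  move=> e eM; rewrite eeqMP //; last first.
    by apply: M_addel; [apply: dX.1|apply: dY.1] => i; exact: eM.
  by split=> h z /h; rewrite mem_addel.
have tX := tdfn_rename (fun n => n.+2) dX.
have tY := tdfn_rename (fun n => n.+2) dY.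
apply: dfn_all; apply: dfn_and; apply: dfn_imp.
- by apply: dfn_mem; exact: tdfn_var.
- by apply: dfn_or; [apply: dfn_mem|apply: dfn_eeq] => //; exact: tdfn_var.
- by apply: dfn_or; [apply: dfn_mem|apply: dfn_eeq] => //; exact: tdfn_var.
- by apply: dfn_mem; exact: tdfn_var.
Qed.

End Definability.

(** * Satisfaction of the derived connectives, and ordinals *)

Lemma sat_imp N e p q : sat N e (FImp p q) <-> (sat N e p -> sat N e q).
Proof.
split=> /= [h hp|h [hp]]; last by apply; exact: h.
by apply: contrapT => nq; exact: h.
Qed.

Lemma sat_iff N e p q : sat N e (FIff p q) <-> (sat N e p <-> sat N e q).
Proof.
by split=> [[/sat_imp h /sat_imp k]|[h k]]; [split|split; apply/sat_imp].
Qed.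

Lemma sat_all N e i p :
  sat N e (FAll i p) <-> forall x, x ∈ N -> sat N (upd e i x) p.
Proof. by []. Qed.

Lemma sat_ex N e i p :
  sat N e (FEx i p) <-> exists x, x ∈ N /\ sat N (upd e i x) p.
Proof.
split=> /= [h|[x [xN hx]] /(_ x xN)//].
by apply: contrapT => k; apply: h => x xN hx; apply: k; exists x.
Qed.

(** A transitive set of transitive sets; since ∈ is well-founded, these are the von Neumann
    ordinals. *)
Definition ord (a : Ens) : Prop :=
  forall z, z ∈ a -> forall w, w ∈ z -> w ∈ a /\ forall v, v ∈ w -> v ∈ z.

Lemma mem_irrefl x : ~ x ∈ x.
Proof. by move: x; apply: mem_ind => x IH xx; exact: (IH x xx xx). Qed.

Lemma ord_elt a b : ord a -> b ∈ a -> ord b.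
Proof.
move=> oa ba z zb w wz.
have [za zz] := oa b ba z zb; have [wa ww] := oa z za w wz.
by split=> //; exact: zz.
Qed.

Lemma ord_trans a : ord a -> transitive_set a.
Proof. by move=> oa z za w wz; have [] := oa z za w wz. Qed.

(** Double ∈-induction: if neither is an element of the other, every element of one is an element of
    the other. *)
Lemma ord_total a b : ord a -> ord b -> [\/ a ∈ b, a ≈ b | b ∈ a].
Proof.
elim/mem_ind: a b => a IHa; elim/mem_ind => b IHb oa ob.
case: (pselect (a ∈ b)) => [|ab]; first by constructor 1.
case: (pselect (b ∈ a)) => [|ba]; first by constructor 3.
constructor 2; apply/eeqP => x; split=> hx.
  have [//|xb|bx] := IHa x hx b (ord_elt oa hx) ob.
    by case: ba; exact: mem_eeql (eeq_sym xb) hx.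
  by case: ba; exact: ord_trans oa _ hx _ bx.
have [ax|ax|//] := IHb x hx oa (ord_elt ob hx).
  by case: ab; exact: ord_trans ob _ hx _ ax.
by case: ab; exact: mem_eeql ax hx.
Qed.

(** * Borel predicates *)

Definition borelp (Q : baire -> Prop) : Prop := Borel [set y | Q y].

Lemma borel_ext Q Q' : (forall y, Q y <-> Q' y) -> borelp Q -> borelp Q'.
Proof.
move=> QQ; rewrite /borelp; suff -> : [set y | Q y] = [set y | Q' y] by [].
by apply/seteqP; split=> y /= /QQ.
Qed.

Lemma borel_not Q : borelp Q -> borelp (fun y => ~ Q y).
Proof.
by move=> /sigma_algebraCD; rewrite setTD.
Qed.

Lemma borel_ex (I : countType) (Q : I -> baire -> Prop) :
  (forall i, borelp (Q i)) -> borelp (fun y => exists i, Q i y).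
Proof.
move=> QB; pose F n : set baire := if unpickle n is Some i then Q i else set0.
have : Borel (\bigcup_n F n).
  apply: sigma_algebra_bigcup => n; rewrite /F.
  by case: unpickle => [i|]; [exact: QB|exact: sigma_algebra0].
apply: borel_ext => y; split=> [[n _]|[i Qi]].
  by rewrite /F; case: unpickle => [i|//] Qi; exists i.
by exists (pickle i) => //; rewrite /F pickleK.
Qed.

Lemma borel_all (I : countType) (Q : I -> baire -> Prop) :
  (forall i, borelp (Q i)) -> borelp (fun y => forall i, Q i y).
Proof.
move=> QB; apply: (@borel_ext (fun y => ~ exists i, ~ Q i y)).
  move=> y; split=> [h i|h [i]]; last by apply; exact: h.
  by apply: contrapT => n; apply: h; exists i.
by apply: borel_not; apply: borel_ex => i; exact: borel_not.
Qed.

Lemma borel_or Q R : borelp Q -> borelp R -> borelp (fun y => Q y \/ R y).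
Proof.
move=> QB RB; apply: (@borel_ext (fun y => exists b : bool, if b then Q y else R y)).
  by move=> y; split=> [[[]]|[]]; [left|right|exists true|exists false].
by apply: borel_ex => -[].
Qed.

Lemma borel_and Q R : borelp Q -> borelp R -> borelp (fun y => Q y /\ R y).
Proof.
move=> QB RB; apply: (@borel_ext (fun y => forall b : bool, if b then Q y else R y)).
  by move=> y; split=> [h|[? ?] []//]; split; [exact: (h true)|exact: (h false)].
by apply: borel_all => -[].
Qed.

Lemma borel_const (Q : Prop) : borelp (fun=> Q).
Proof.
case: (pselect Q) => h.
  apply: (@borel_ext (fun=> ~ False)); first by move=> y; tauto.
  by apply: borel_not; exact: sigma_algebra0.
by apply: (@borel_ext (fun=> False)) => [y|]; [tauto|exact: sigma_algebra0].
Qed.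

Lemma borel_imp Q R : borelp Q -> borelp R -> borelp (fun y => Q y -> R y).
Proof.
move=> QB RB; apply: (@borel_ext (fun y => ~ Q y \/ R y)).
  by move=> y; split=> [[]//|h]; case: (pselect (Q y)) => [/h|]; [right|left].
by apply: borel_or RB; exact: borel_not.
Qed.

Lemma borel_coord n m : borelp (fun y => y n = m).
Proof.
apply: sub_sigma_algebra.
apply: (@open_comp _ _ (fun y : baire => y n) [set m]).
  by move=> y _; exact: (@proj_continuous _ (fun _ : nat => nat) n).
exact: discrete_open.
Qed.

(** * Closure properties of models of ZFC *)

Section Model.
Context (M : Ens) (c : nat -> Ens).
Hypothesis cM : forall n, c n ∈ M.
Hypothesis cS : forall x, x ∈ M -> exists n, x ≈ c n.
Hypothesis Mtr : transitive_set M.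
Hypothesis Mzfc : models M ZFC.

Notation D := (dfn M c).
Notation TD := (tdfn M c).

Lemma separation (Q : Ens -> Prop) A : D (fun e => Q (e 0)) -> A ∈ M ->
  exists B, B ∈ M /\ forall x, x ∈ B <-> x ∈ A /\ Q x.
Proof.
move=> [p h] AM.
(* The axiom uses 0 for the element, 1 for the new set and 2 for the given set. Arguments go to 0
   and parameters to 3 and beyond, so 1 is not free. *)
pose s i := if i is k.+1 then (if odd k then k./2 + 3 else 0) else 3.
have [q [h1 h2]] := sat_rename p s.
have q1 : ~~ free 1 q.
  by apply/negP => /h2[[|k]]; rewrite /s //; case: ifP; rewrite ?addn3.
have := Mzfc.2 _ (ax_separation q1) (fun i => if i is k.+3 then c k else c 0).
have eM i : (if i is k.+3 then c k else c 0) ∈ M by case: i => [|[|[|i]]].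
move=> /(_ eM)/sat_all/(_ A AM)/sat_ex[B [BM /sat_all hB]]; exists B; split=> // x.
split=> [xB|[xA Qx]].
- have xM := Mtr BM xB.
  have /sat_iff[/(_ xB)[/= xA xq] _] := hB x xM; split=> //.
  apply/(h (fun _ => x)) => //; move/h1: xq; apply: iffLR.
  apply: sat_eeq => -[|k] _; rewrite /s /upd /=; first exact: eeq_refl.
  by case: (odd k); rewrite ?addn3; exact: eeq_refl.
- have xM := Mtr AM xA.
  have /sat_iff[_] := hB x xM; apply; split=> //; apply/h1.
  have /(h (fun _ => x)) : forall i : nat, x ∈ M by [].
  move=> /iffLR/(_ Qx); apply: iffLR.
  apply: sat_eeq => -[|k] _; rewrite /s /upd /=; first exact: eeq_refl.
  by case: (odd k); rewrite ?addn3; exact: eeq_refl.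
Qed.

Lemma replacement (Q : Ens -> Ens -> Prop) A :
  D (fun e => Q (e 0) (e 1)) -> A ∈ M ->
  (forall x, x ∈ A -> exists y, y ∈ M /\
     forall z, z ∈ M -> (Q x z <-> z ≈ y)) ->
  exists B, B ∈ M /\ forall x, x ∈ A -> exists y, y ∈ B /\ Q x y.
Proof.
move=> [p h] AM fun_Q.
(* The argument [x] goes to 0, the later arguments, all equal to [y], go to 1, and the parameters
   start at 5; hence 3 and 4 are not free. *)
pose s i := match i with
  | 0 => 5 | 1 => 0 | k.+1 => if odd k then k./2 + 5 else 1 end.
have [q [h1 h2]] := sat_rename p s.
have [q3 q4] : ~~ free 3 q /\ ~~ free 4 q.
  by split; apply/negP => /h2[[|[|k]]]; rewrite /s //; case: ifP;
    rewrite ?addnS.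
pose e0 i := if i is k.+4.+1 then c k else c 0.
have e0M i : e0 i ∈ M by rewrite /e0; case: i => [|[|[|[|[|i]]]]].
pose exy x y := upd (upd (upd e0 2 A) 0 x) 1 y.
have key x y e : x ∈ M -> y ∈ M -> (forall i, i != 3 -> i != 4 -> e i = exy x y i) ->
    (sat M e q <-> Q x y).
  move=> xM yM ee.
  pose e1 := scons x (fun _ => y).
  have eM : env_in M e1 by case.
  rewrite (h e1 eM) h1; apply: sat_eeq => i _.
  rewrite ee; last 2 first.
  - by case: i => [|[|k]]; rewrite /s //; case: ifP; rewrite ?addnS.
  - by case: i => [|[|k]]; rewrite /s //; case: ifP; rewrite ?addnS.
  case: i => [|[|k]]; try by rewrite /s /exy /upd /=; exact: eeq_refl.
  have -> : mix c e1 k.+2 = if odd k.+1 then c k.+1./2 else y.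
    by rewrite /mix; case: ifP => // ok; case: k ok => [|[|k]].
  have -> : s k.+2 = if odd k.+1 then k.+1./2 + 5 else 1 by [].
  case: (odd k.+1); last by rewrite /exy /upd /=; exact: eeq_refl.
  by rewrite !addnS addn0 /exy /upd /=; exact: eeq_refl.
have := Mzfc.2 _ (ax_replacement q3 q4) e0 e0M.
move=> /sat_all/(_ A AM)/sat_imp H.
have /H/sat_ex[B [BM /sat_all hB]] :
    sat M (upd e0 2 A) (FAllin 0 2 (FEx 4 (FAll 1 (FIff q (FEq 1 4))))).
  rewrite /FAllin; apply/sat_all => x xM; apply/sat_imp => xA.
  rewrite /= in xA.
  have [y [yM hy]] := fun_Q x xA.
  apply/sat_ex; exists y; split=> //; apply/sat_all => z zM; apply/sat_iff.
  rewrite (@key x z) //= ?hy //.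
  by case=> [|[|[|[|[|i]]]]].
exists B; split=> // x xA; have xM := Mtr AM xA.
have /sat_imp/(_ xA)/sat_ex[y [yM [yB yq]]] := hB x xM.
exists y; split=> //; apply: (iffLR (key x y _ xM yM _) yq).
by case=> [|[|[|[|[|i]]]]].
Qed.

(** The axiom gives only a superset of the pair, which separation cuts down; unions and power sets
    are treated likewise. *)
Lemma M_pair x y : x ∈ M -> y ∈ M -> upair x y ∈ M.
Proof.
move=> xM yM.
have /sat_all/(_ x xM)/sat_all/(_ y yM)/sat_ex[w [wM [/= xw yw]]] :=
  Mzfc.2 _ ax_pairing c cM.
have dQ : D (fun e => e 0 ≈ x \/ e 0 ≈ y).
  by apply: dfn_or; apply: dfn_eeq => //; do ?[exact: tdfn_var|exact: tdfn_const].
have [B [BM hB]] := separation (Q := fun z => z ≈ x \/ z ≈ y) dQ wM.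
apply: mem_eeql BM; apply/eeqP => z; rewrite hB mem_upair; split=> [h|[]//].
by split=> //; case: h => /mem_eeql; exact.
Qed.

Lemma M_opair x y : x ∈ M -> y ∈ M -> opair x y ∈ M.
Proof. by move=> xM yM; do 2!apply: M_pair => //. Qed.

Lemma M_opairE x y : opair x y ∈ M -> x ∈ M /\ y ∈ M.
Proof.
move=> pM; have h : upair x y ∈ M.
  by apply: (Mtr pM); apply/mem_upair; right; exact: eeq_refl.
by split; apply: (Mtr h); apply/mem_upair; [left|right]; exact: eeq_refl.
Qed.

Lemma M_union A : A ∈ M ->
  exists B, B ∈ M /\ forall x, x ∈ B <-> exists w, w ∈ A /\ x ∈ w.
Proof.
move=> AM.
have /sat_all/(_ A AM)/sat_ex[W [WM /sat_all hW]] := Mzfc.2 _ ax_union c cM.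
have dQ : D (fun e => exists w, w ∈ M /\ (w ∈ A /\ e 0 ∈ w)).
  apply: dfn_ex; apply: dfn_and; apply: dfn_mem => //;
    do ?[exact: tdfn_var|exact: tdfn_const].
have [B [BM hB]] :=
  separation (Q := fun x => exists w, w ∈ M /\ (w ∈ A /\ x ∈ w)) dQ WM.
exists B; split=> // x; rewrite hB; split=> [[_ [w [_ []]]]|[w [wA xw]]].
  by exists w.
have wM := Mtr AM wA; split; last by exists w.
have /sat_imp/(_ wA)/sat_all/(_ x (Mtr wM xw))/sat_imp := hW w wM.
exact.
Qed.

Lemma M_addel x y : x ∈ M -> y ∈ M -> addel x y ∈ M.
Proof.
move=> xM yM.
have := M_union (M_pair xM (M_pair yM yM)).
move=> [B [BM hB]]; apply: mem_eeql BM; apply/eeqP => z.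
rewrite hB mem_addel; split=> [[h|h]|[w [/mem_upair[wx|wy] zw]]].
- by exists x; split=> //; apply/mem_upair; left; exact: eeq_refl.
- exists (upair y y); split; first by apply/mem_upair; right; exact: eeq_refl.
  by apply/mem_upair; left.
- by left; exact: mem_eeqr zw.
- by right; have := mem_eeqr wy zw => /mem_upair[].
Qed.

Lemma M_power A : A ∈ M ->
  exists B, B ∈ M /\ forall x, x ∈ B <-> x ∈ M /\ x ⊆ A.
Proof.
move=> AM.
have /sat_all/(_ A AM)/sat_ex[W [WM /sat_all hW]] := Mzfc.2 _ ax_power c cM.
have dQ : D (fun e => forall z, z ∈ M -> z ∈ e 0 -> z ∈ A).
  apply: dfn_all; apply: dfn_imp; apply: dfn_mem => //;
    do ?[exact: tdfn_var|exact: tdfn_const].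
have [B [BM hB]] :=
  separation (Q := fun x => forall z, z ∈ M -> z ∈ x -> z ∈ A) dQ WM.
exists B; split=> // x; rewrite hB; split=> [[xW h]|[xM xA]].
  by have xM := Mtr WM xW; split=> // z zx; apply: h => //; exact: (Mtr xM).
split=> [|z _]; last exact: xA.
have /sat_imp := hW x xM; apply; apply/sat_all => z zM; apply/sat_imp; exact: xA.
Qed.

Lemma M_empty : exists B, B ∈ M /\ forall x, ~ x ∈ B.
Proof.
have dQ : D (fun e => e 0 ∈ e 0 /\ ~ e 0 ∈ e 0).
  by apply: dfn_and; last apply: dfn_not; apply: dfn_mem => //; exact: tdfn_var.
have [B [BM hB]] := separation (Q := fun x => x ∈ x /\ ~ x ∈ x) dQ (cM 0).
by exists B; split=> // x /hB[_ []].
Qed.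

(** Proves definability along the syntax of a predicate, stopping at predicates whose definability
    has to be supplied. *)
Ltac dfn := repeat (first
  [ exact: tdfn_var
  | (apply: (tdfn_const cS); assumption)
  | match goal with
    | H : tdfn _ _ ?X |- tdfn _ _ ?X => exact H
    | H : tdfn _ _ ?X |- tdfn _ _ (fun e => ?X (@?f e)) =>
        refine (tdfn_rename _ H) end
  | refine (tdfn_opair Mtr M_pair _ _)
  | refine (tdfn_addel Mtr M_addel _ _)
  | apply: dfn_all | apply: dfn_ex | apply: dfn_and | apply: dfn_or
  | apply: dfn_not | apply: dfn_imp
  | apply: dfn_mem | apply: dfn_eeq ]; cbv beta).

Definition transitive_in (x : Ens) :=
  forall z, z ∈ M -> z ∈ x -> forall w, w ∈ M -> w ∈ z -> w ∈ x.

Lemma transitive_inP x : x ∈ M -> (transitive_in x <-> transitive_set x).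
Proof.
move=> xM; split=> h z; last by move=> _ /h zx w _ /zx.
by move=> zx w wz; have zM := Mtr xM zx; apply: (h z) => //; exact: (Mtr zM).
Qed.

(** By ∈-induction outside [M], each [y] in [x] has a least transitive superset in [M]; replacement
    collects these, and their union together with [x] is transitive. *)
Lemma transitive_closure x : x ∈ M ->
  exists T, [/\ T ∈ M, transitive_set T & x ∈ T].
Proof.
move=> xM; suff H : exists T, [/\ T ∈ M, transitive_set T & x ⊆ T].
  have [T [TM Ttr xT]] := H; exists (addel T x); split.
  - exact: M_addel.
  - move=> z /mem_addel[zT|zx] w wz; apply/mem_addel; left.
      exact: (Ttr z zT).
    by apply: xT; exact: mem_eeqr zx wz.
  - by apply/mem_addel; right; exact: eeq_refl.
elim/mem_ind: x xM => x IH xM.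
(* [Q y T]: among the transitive sets of [M] including [y], [T] is the least. Leastness gives the
   uniqueness that replacement demands. *)
pose Q y T := (transitive_in T /\ (forall z, z ∈ M -> z ∈ y -> z ∈ T)) /\
  forall S, S ∈ M -> transitive_in S -> (forall z, z ∈ M -> z ∈ y -> z ∈ S) ->
  forall z, z ∈ M -> z ∈ T -> z ∈ S.
have dQ : D (fun e => Q (e 0) (e 1)) by rewrite /Q /transitive_in; dfn.
have [y yx|B [BM hB]] := replacement dQ xM.
  have yM := Mtr xM yx; have [T [TM Ttr yT]] := IH y yx yM.
  pose R z := forall S, S ∈ M -> transitive_in S ->
    (forall z, z ∈ M -> z ∈ y -> z ∈ S) ->
    z ∈ S.
  have dR : D (fun e => R (e 0)) by rewrite /R /transitive_in; dfn.
  have [T' [T'M hT']] := separation dR TM.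
  have QT' : Q y T'.
    split; last by move=> S SM St yS z _ /hT'[_]; exact.
    split=> [z zM /hT'[zT Rz] w wM wz|z zM zy]; apply/hT'; split.
    - exact: Ttr zT _ wz.
    - by move=> S SM St yS; apply: (St z) => //; exact: Rz.
    - exact: yT.
    - by move=> S SM St; exact.
  exists T'; split=> // S SM; split=> [[[St yS] Smin]|ST'].
    apply/eeqP => z; split=> hz.
      by apply: (Smin T') => //; [exact: QT'.1.1|exact: QT'.1.2|exact: Mtr hz].
    by apply: (QT'.2 S) => //; exact: Mtr hz.
  case: QT' => -[h1 h2] h3; split; first split.
  - by move=> z zM /(mem_eeqr ST') /(h1 z zM) k w wM /(k w wM);
      exact: mem_eeqr (eeq_sym ST').
  - by move=> z zM /(h2 z zM); exact: mem_eeqr (eeq_sym ST').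
  - by move=> S' S'M S't yS' z zM /(mem_eeqr ST'); exact: h3.
(* The set given by replacement may have extra elements; keeping only the transitive ones makes the
   union transitive. *)
have dt : D (fun e => transitive_in (e 0)) by rewrite /transitive_in; dfn.
have [B' [B'M hB']] := separation dt BM.
have [U [UM hU]] := M_union B'M.
have Utr : transitive_set U.
  move=> z /hU[w [wB zw]] v vz; apply/hU; exists w; split=> //.
  have wM := Mtr B'M wB.
  by have /hB'[_ /(transitive_inP wM) h] := wB; exact: (h z).
have xUV z : z ∈ x -> z ⊆ U.
  move=> zx w wz; have [T [TB [[h1 h2] _]]] := hB z zx.
  apply/hU; exists T; split; first by apply/hB'.
  by apply: h2 => //; exact: Mtr (Mtr xM zx) _ wz.
have [V [VM hV]] := M_union (M_pair UM xM).
exists V; split=> //.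
  move=> z /hV[w [/mem_upair[wU|wx] zw]] v vz; apply/hV; exists U;
    (split; first by apply/mem_upair; left; exact: eeq_refl).
    by apply: (Utr z) => //; exact: mem_eeqr wU zw.
  by apply: (xUV z) => //; exact: mem_eeqr wx zw.
move=> z zx; apply/hV; exists x; split=> //.
by apply/mem_upair; right; exact: eeq_refl.
Qed.

(** [f] is the intersection of all sets of [M] that are closed under the operator, cut out of [V] by
    separation. *)
Lemma knaster_tarski (R : Ens -> Ens -> Prop) V :
  (forall X Y, TD X -> TD Y -> D (fun e => R (X e) (Y e))) ->
  (forall g h z, g ⊆ h -> R g z -> R h z) -> V ∈ M ->
  exists f, f ∈ M /\ forall z, z ∈ f <-> z ∈ V /\ R f z.
Proof.
move=> dR mono VM.
pose S z := forall g, g ∈ M -> (forall w, w ∈ M -> w ∈ V -> R g w -> w ∈ g) ->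
  z ∈ g.
have dS : D (fun e => S (e 0)).
  by rewrite /S; dfn; apply: dR; dfn.
have [f [fM hf]] := separation dS VM; exists f; split=> //.
have pre z : z ∈ V -> R f z -> z ∈ f.
  move=> zV Rz; apply/hf; split=> // g gM hg; apply: (hg z) => //.
    exact: Mtr zV.
  by apply: mono Rz => w /hf[_ Sw]; exact: Sw.
have dRf : D (fun e => R f (e 0)) by apply: dR; dfn.
have [f' [f'M hf']] := separation dRf VM.
move=> z; split=> [zf|[]]; last exact: pre.
have /hf[zV Sz] := zf; split=> //.
suff /hf'[] : z ∈ f' by [].
apply: Sz => // w wM wV Rw; apply/hf'; split=> //; apply: mono Rw.
by move=> v /hf'[vV Rv]; exact: pre.
Qed.

Lemma ordMP a : a ∈ M -> (ord a <->
  forall z, z ∈ M -> z ∈ a -> forall w, w ∈ M -> w ∈ z ->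
  w ∈ a /\ forall v, v ∈ M -> v ∈ w -> v ∈ z).
Proof.
move=> aM; split=> h z.
  by move=> zM za w wM wz; have [k l] := h z za w wz; split=> // v _; exact: l.
move=> za w wz; have zM := Mtr aM za; have wM := Mtr zM wz.
have [k l] := h z zM za w wM wz; split=> // v vw.
by apply: l => //; exact: Mtr vw.
Qed.

Lemma dfn_ord X : TD X -> D (fun e => ord (X e)).
Proof.
move=> dX; apply: (@dfn_ext _ _ _ (fun e => forall z, z ∈ M -> z ∈ X e ->
  forall w, w ∈ M -> w ∈ z -> w ∈ X e /\ forall v, v ∈ M -> v ∈ w -> v ∈ z)).
  by move=> e eM; rewrite ordMP //; exact: dX.1.
by dfn.
Qed.

(** The least ordinal [a] with [O a x] is unique, so replacement collects these ordinals in [M], and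
    [A] is taken above all of them. *)
Lemma ord_collection (O : Ens -> Ens -> Prop) K :
  (forall X Y, TD X -> TD Y -> D (fun e => O (X e) (Y e))) ->
  (forall a b x, a ≈ b -> O a x -> O b x) -> K ∈ M ->
  exists A, [/\ A ∈ M, ord A & forall x a, x ∈ K -> a ∈ M -> ord a -> O a x ->
    exists b, b ∈ A /\ O b x].
Proof.
move=> dO Oe KM.
pose Q x a := ord a /\ (O a x /\ forall b, b ∈ M -> b ∈ a -> ~ O b x).
have dQ : D (fun e => Q (e 0) (e 1)).
  by apply: dfn_and; [apply: dfn_ord; dfn|dfn; apply: dO; dfn].
have dE : D (fun e => exists a, a ∈ M /\ (ord a /\ O a (e 0))).
  by dfn; [apply: dfn_ord|apply: dO]; dfn.
have [K' [K'M hK']] :=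
  separation (Q := fun x => exists a, a ∈ M /\ (ord a /\ O a x)) dE KM.
have [x /hK'[_ [a [aM [oa Oa]]]]|B [BM hB]] := replacement dQ K'M.
  have [b [bM Qb]] : exists b, b ∈ M /\ Q x b.
    elim/mem_ind: a aM oa Oa => a IH aM oa Oa.
    case: (pselect (exists b, b ∈ a /\ O b x)) => [[b [ba Ob]]|na].
      by apply: IH Ob => //; [exact: Mtr ba|exact: ord_elt ba].
    by exists a; split=> //; split=> //; split=> // b _ ba Ob; apply: na; exists b.
  exists b; split=> // d dM; split=> [[od [Od dmin]]|db].
    case: Qb => ob [Ob bmin]; have [db|//|bd] := ord_total od ob.
      by case: (bmin _ dM db).
    by case: (dmin _ bM bd).
  case: Qb => ob [Ob bmin]; split; last split.
  - move=> z /(mem_eeqr db) zb w wz; have [k l] := ob z zb w wz; split=> //.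
    exact: mem_eeqr (eeq_sym db) k.
  - exact: Oe (eeq_sym db) Ob.
  - by move=> v vM /(mem_eeqr db); exact: bmin.
have dOr : D (fun e => ord (e 0)) by apply: dfn_ord; dfn.
have [B' [B'M hB']] := separation dOr BM.
have [U [UM hU]] := M_union B'M.
have oU : ord U.
  move=> z /hU[a [aB za]] w wz; have /hB'[_ oa] := aB.
  have [wa wz'] := oa z za w wz; split=> //; apply/hU; by exists a.
(* The successor of the union, so that even a largest collected ordinal is an element of it. *)
exists (addel U U); split; first exact: M_addel.
  move=> z /mem_addel[zU|zU] w wz.
    by have [wU wz'] := oU z zU w wz; split=> //; apply/mem_addel; left.
  have wU := mem_eeqr zU wz; split; first by apply/mem_addel; left.
  by move=> v vw; apply: mem_eeqr (eeq_sym zU) _; exact: ord_trans wU _ vw.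
move=> x a xK aM oa Oa.
have /hB[b [bB [ob [Ob _]]]] : x ∈ K' by apply/hK'; split=> //; exists a.
exists b; split=> //; apply/mem_addel.
have [|?|Ub] := ord_total ob oU; [by left|by right|].
case: (@mem_irrefl U); apply/hU; exists b; split=> //.
by apply/hB'.
Qed.

(** A Kuratowski pair lies in the double power set of the union of [A] and [B]. *)
Lemma product_bound A B : A ∈ M -> B ∈ M ->
  exists C, C ∈ M /\ forall x y, x ∈ A -> y ∈ B -> opair x y ∈ C.
Proof.
move=> AM BM; have [V [VM hV]] := M_union (M_pair AM BM).
have [W [WM hW]] := M_power VM; have [C [CM hC]] := M_power WM.
exists C; split=> // x y xA yB.
have xM := Mtr AM xA; have yM := Mtr BM yB.
have xV : x ∈ V.
  by apply/hV; exists A; split=> //; apply/mem_upair; left; exact: eeq_refl.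
have yV : y ∈ V.
  by apply/hV; exists B; split=> //; apply/mem_upair; right; exact: eeq_refl.
have pW u v : u ∈ V -> v ∈ V -> upair u v ∈ W.
  move=> uV vV; apply/hW; split; first exact: M_pair (Mtr VM uV) (Mtr VM vV).
  by move=> z /mem_upair[] /mem_eeql; exact.
apply/hC; split; first exact: M_opair.
by move=> z /mem_upair[] /mem_eeql; apply; exact: pW.
Qed.

(** * Killed states, as forced over M *)

Context (P le U : Ens).
Hypothesis PM : P ∈ M.
Hypothesis leM : le ∈ M.
Hypothesis UM : U ∈ M.
Hypothesis Utr : transitive_set U.
Hypothesis Pforcing : forcing_notion P le.

Notation LE q p := (opair q p ∈ le).

Lemma stronger_dom q p : LE q p -> q ∈ P /\ p ∈ P.
Proof.
case: Pforcing => _ h _ _ /h[q' [p' [qP pP /opair_inj[qq pp]]]].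
by split; [exact: mem_eeql qq qP|exact: mem_eeql pp pP].
Qed.

Lemma stronger_refl p : p ∈ P -> LE p p.
Proof. by case: Pforcing => _ _ h _; exact: h. Qed.

Lemma stronger_trans p q r : LE p q -> LE q r -> LE p r.
Proof. by case: Pforcing => _ _ _; exact. Qed.

Lemma P_M p : p ∈ P -> p ∈ M.
Proof. exact: Mtr. Qed.

Lemma stronger_M q p : LE q p -> q ∈ M.
Proof. by move=> /stronger_dom[/P_M]. Qed.

(** Confining requirements to pairs from [U] makes all states range over a single set of [M]. *)
Definition name_rel (F : Ens) : Prop := forall z, z ∈ M -> z ∈ F ->
  exists rho, rho ∈ M /\ (rho ∈ U /\
  exists sig, sig ∈ M /\ (sig ∈ U /\ z ≈ opair rho sig)).

Lemma name_rel_elt F rho sig : F ∈ M -> name_rel F -> opair rho sig ∈ F ->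
  rho ∈ U /\ sig ∈ U.
Proof.
move=> FM gF zF.
have [r [_ [rU [s [_ [sU /opair_inj[rr ss]]]]]]] := gF _ (Mtr FM zF) zF.
by split; [exact: mem_eeql rr rU|exact: mem_eeql ss sU].
Qed.

Lemma name_rel_addel F rho sig : name_rel F -> rho ∈ U -> sig ∈ U ->
  name_rel (addel F (opair rho sig)).
Proof.
move=> gF rU sU z zM /mem_addel[zF|ze]; first exact: gF.
exists rho; split; first exact: Mtr rU.
split=> //; exists sig; split; first exact: Mtr sU.
by split.
Qed.

Lemma opair_mem_tr S x y z : transitive_set S -> z ∈ S -> opair x y ∈ z -> x ∈ S.
Proof.
move=> Str zS xyz; apply: (Str (upair x x)).
  apply: (Str (opair x y)); first exact: Str xyz.
  by apply/mem_upair; left; exact: eeq_refl.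
by apply/mem_upair; left; exact: eeq_refl.
Qed.

Definition dense_below (L : Ens -> Ens -> Ens -> Prop) r p F :=
  forall r', r' ∈ M -> LE r' r -> exists r'', r'' ∈ M /\ (LE r'' r' /\ L r'' p F).

(* [kill_step] as seen from another generic filter: F is a set of pairs (rho, sig)
   of names, and r forces that the condition p with the requirements
   sig[G'] = rho[G], for (rho, sig) in F, is given up. *)
Definition fdead_rule (L : Ens -> Ens -> Ens -> Prop) r p F : Prop :=
  (forall q, q ∈ M -> LE q p ->
    exists q', q' ∈ M /\ (LE q' q /\ dense_below L r q' F))
  \/ (exists rho, rho ∈ M /\ exists sig, sig ∈ M /\ exists s, s ∈ M /\
      exists p', p' ∈ M /\ (opair rho sig ∈ F /\ (opair s p' ∈ sig /\ (LE p p' /\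
      forall rho', rho' ∈ M -> forall r', r' ∈ M -> opair rho' r' ∈ rho ->
      forall r1, r1 ∈ M -> LE r1 r -> LE r1 r' -> forall q, q ∈ M -> LE q p ->
      dense_below L r1 q (addel F (opair rho' s))))))
  \/ (exists rho, rho ∈ M /\ exists sig, sig ∈ M /\ exists rho', rho' ∈ M /\
      exists r', r' ∈ M /\ (opair rho sig ∈ F /\ (opair rho' r' ∈ rho /\ (LE r r' /\
      forall s, s ∈ M -> forall p', p' ∈ M -> opair s p' ∈ sig ->
      forall q, q ∈ M -> LE q p -> LE q p' ->
      dense_below L r q (addel F (opair rho' s)))))).

(** The rule is asked for densely below [r], as in the forcing clauses for disjunction and
    existence. *)
Definition fdead_step L := dense_below (fdead_rule L).

Lemma dense_below_mono L L' r r' p F F' : LE r' r ->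
  (forall r1, r1 ∈ P -> L r1 p F -> L' r1 p F') ->
  dense_below L r p F -> dense_below L' r' p F'.
Proof.
move=> rr LL h r1 r1M r1r.
have [r2 [r2M [r2r hL]]] := h r1 r1M (stronger_trans r1r rr).
exists r2; split=> //; split=> //; apply: LL => //.
by have [] := stronger_dom r2r.
Qed.

Section Mono.
Context (L L' : Ens -> Ens -> Ens -> Prop).
Hypothesis LL : forall r p F F', r ∈ P -> p ∈ P -> F ∈ M -> name_rel F -> F ≈ F' ->
  L r p F -> L' r p F'.

(** Each clause speaks of all extensions of [r] and [p], or of conditions above them, and contains
    [L] only positively. *)
Lemma fdead_rule_mono r r' p p' F F' : LE r' r -> LE p' p -> F ∈ M -> name_rel F ->
  F ≈ F' -> fdead_rule L r p F -> fdead_rule L' r' p' F'.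
Proof.
move=> rr pp FM gF FF.
have step q r1 r2 rho s : LE r2 r1 -> q ∈ P -> rho ∈ U -> s ∈ U ->
    dense_below L r1 q (addel F (opair rho s)) ->
    dense_below L' r2 q (addel F' (opair rho s)).
  move=> r21 qP rU sU; apply: dense_below_mono => // r3 r3P; apply: LL => //.
  - by apply: M_addel => //; apply: M_opair; [exact: Mtr rU|exact: Mtr sU].
  - exact: name_rel_addel.
  - by apply/eeqP => z; rewrite !mem_addel (eeq_memr z FF).
case=> [h|[|]].
- left=> q qM qp; have [q' [q'M [q'q hq]]] := h q qM (stronger_trans qp pp).
  have [q'P _] := stronger_dom q'q.
  exists q'; split=> //; split=> //; apply: dense_below_mono hq => // r1 r1P.
  exact: LL.
- move=> [rho [rhoM [sig [sigM [s [sM [p1 [p1M [rsF [sp [pp1 h]]]]]]]]]]].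
  have [rU sU] := name_rel_elt FM gF rsF.
  right; left; exists rho; split=> //; exists sig; split=> //; exists s; split=> //.
  exists p1; split=> //; split; first exact: mem_eeqr FF rsF.
  split=> //; split; first exact: stronger_trans pp pp1.
  move=> rho' rho'M r1 r1M r1rho r2 r2M r2r r21 q qM qp.
  have [r2P _] := stronger_dom r2r; have [qP _] := stronger_dom qp.
  apply: step (h rho' rho'M r1 r1M r1rho r2 r2M (stronger_trans r2r rr) r21 q qM
    (stronger_trans qp pp)) => //; first exact: stronger_refl.
    exact: opair_mem_tr r1rho.
  exact: opair_mem_tr sp.
- move=> [rho [rhoM [sig [sigM [rho' [rho'M [r1 [r1M [rsF [sp [rr1 h]]]]]]]]]]].
  have [rU sU] := name_rel_elt FM gF rsF.
  right; right; exists rho; split=> //; exists sig; split=> //; exists rho'.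
  split=> //; exists r1; split=> //; split; first exact: mem_eeqr FF rsF.
  split=> //; split; first exact: stronger_trans rr rr1.
  move=> s sM p1 p1M sp1 q qM qp qp1; have [qP _] := stronger_dom qp.
  apply: step (h s sM p1 p1M sp1 q qM (stronger_trans qp pp) qp1) => //.
    exact: opair_mem_tr sp.
  exact: opair_mem_tr sp1.
Qed.

Lemma fdead_step_mono r r' p p' F F' : LE r' r -> LE p' p -> F ∈ M -> name_rel F ->
  F ≈ F' -> fdead_step L r p F -> fdead_step L' r' p' F'.
Proof.
move=> rr pp FM gF FF h r1 r1M r1r.
have [r2 [r2M [r2r hL]]] := h r1 r1M (stronger_trans r1r rr).
exists r2; split=> //; split=> //; apply: fdead_rule_mono hL => //;
  apply: stronger_refl.
by have [] := stronger_dom r2r.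
Qed.

End Mono.

Definition below (f b r p F : Ens) : Prop :=
  exists b', b' ∈ M /\ (b' ∈ b /\ opair b' (opair r (opair p F)) ∈ f).

(* Stages of the induction are computed in M by approximations on a transitive set:
   these exist by [knaster_tarski] and agree by ∈-induction, so that no recursion
   theorem inside M is needed. *)
Definition approx (f S : Ens) : Prop := transitive_in S /\
  forall b, b ∈ M -> b ∈ S -> forall r, r ∈ M -> r ∈ P -> forall p, p ∈ M ->
  p ∈ P -> forall F, F ∈ M -> name_rel F ->
  (opair b (opair r (opair p F)) ∈ f -> fdead_step (below f b) r p F) /\
  (fdead_step (below f b) r p F -> opair b (opair r (opair p F)) ∈ f).

Definition fdead (a x : Ens) : Prop := exists f, f ∈ M /\ exists S, S ∈ M /\
  (approx f S /\ (a ∈ S /\ opair a x ∈ f)).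

Lemma dfn_fdead X Y : TD X -> TD Y -> D (fun e => fdead (X e) (Y e)).
Proof.
move=> dX dY; rewrite /fdead /approx /fdead_step /dense_below /fdead_rule.
by rewrite /dense_below /below /transitive_in /name_rel; dfn.
Qed.

Lemma fdead_eeq a a' x x' : a ≈ a' -> x ≈ x' -> fdead a x -> fdead a' x'.
Proof.
move=> aa xx [f [fM [S [SM [fS [aS axf]]]]]]; exists f; split=> //; exists S.
split=> //; split=> //; split; first exact: mem_eeql (eeq_sym aa) aS.
exact: mem_eeql (eeq_sym (opair_eeq aa xx)) axf.
Qed.

Lemma code_eeq b r p F F' : F ≈ F' ->
  opair b (opair r (opair p F)) ≈ opair b (opair r (opair p F')).
Proof.
move=> FF; apply: opair_eeq (eeq_refl _) _.
exact: opair_eeq (eeq_refl _) (opair_eeq (eeq_refl _) FF).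
Qed.

(** ∈-induction on [b]: the rule at [b] looks only at stages in [b], which both transitive domains
    contain. *)
Lemma approx_agree f f' S S' b r p F : S ∈ M -> S' ∈ M ->
  approx f S -> approx f' S' -> b ∈ S -> b ∈ S' ->
  r ∈ P -> p ∈ P -> F ∈ M -> name_rel F ->
  opair b (opair r (opair p F)) ∈ f -> opair b (opair r (opair p F)) ∈ f'.
Proof.
move=> SM S'M fS fS'; elim/mem_ind: b r p F => b IH r p F bS bS' rP pP FM gF.
have bM := Mtr SM bS.
move=> /(proj1 (fS.2 b bM bS r (P_M rP) rP p (P_M pP) pP F FM gF)) h.
apply: (proj2 (fS'.2 b bM bS' r (P_M rP) rP p (P_M pP) pP F FM gF)).
apply: fdead_step_mono h => //;
  [|exact: stronger_refl|exact: stronger_refl|exact: eeq_refl].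
move=> r1 p1 F1 F2 r1P p1P F1M gF1 FF [b' [b'M [b'b h]]].
exists b'; split=> //; split=> //.
apply: (@mem_eeql _ (opair b' (opair r1 (opair p1 F1)))).
  exact: code_eeq (eeq_sym FF).
apply: IH h => //.
- by have /(transitive_inP SM) h := fS.1; exact: h _ bS _ b'b.
- by have /(transitive_inP S'M) h := fS'.1; exact: h _ bS' _ b'b.
Qed.

(** Any fixed point of the step operator on the codes of stages and states is an approximation, and
    monotonicity provides one. *)
Lemma approx_ex a : a ∈ M -> exists f S, [/\ f ∈ M, S ∈ M, approx f S & a ∈ S].
Proof.
move=> aM; have [S [SM Str aS]] := transitive_closure aM.
have [C0 [C0M hC0]] := product_bound UM UM.
have [C1 [C1M hC1]] := M_power C0M.
have [C2 [C2M hC2]] := product_bound PM C1M.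
have [C3 [C3M hC3]] := product_bound PM C2M.
have [V [VM hV]] := product_bound SM C3M.
(* The components of a code are determined only up to ≈, so [R] quantifies over all decodings of
   [z]. *)
pose R f z := forall b, b ∈ M -> forall r, r ∈ M -> r ∈ P -> forall p, p ∈ M ->
  p ∈ P -> forall F, F ∈ M -> name_rel F -> z ≈ opair b (opair r (opair p F)) ->
  fdead_step (below f b) r p F.
have [||f [fM hf]] := @knaster_tarski R V _ _ VM.
- move=> X Y dX dY; rewrite /R /fdead_step /dense_below /fdead_rule.
  by rewrite /dense_below /below /name_rel; dfn.
- move=> g h z gh Rz b bM r rM rP p pM pP F FM gF ze.
  apply: fdead_step_mono (Rz b bM r rM rP p pM pP F FM gF ze) => //;
    [|exact: stronger_refl|exact: stronger_refl|exact: eeq_refl].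
  move=> r1 p1 F1 F2 r1P p1P F1M gF1 FF [b' [b'M [b'b k]]].
  exists b'; split=> //; split=> //; apply: gh; apply: mem_eeql k.
  exact: code_eeq (eeq_sym FF).
exists f, S; split=> //; split; first exact/transitive_inP.
move=> b bM bS r rM rP p pM pP F FM gF; split.
  by move=> /hf[_]; apply=> //; exact: eeq_refl.
move=> h; apply/hf; split.
  apply: hV => //; apply: hC3 => //; apply: hC2 => //; apply/hC1; split=> // z zF.
  have [rho [_ [rU [sig [_ [sU ze]]]]]] := gF z (Mtr FM zF) zF.
  by apply: mem_eeql ze _; exact: hC0.
move=> b1 b1M r1 r1M r1P p1 p1M p1P F1 F1M gF1.
move=> /opair_inj[bb /opair_inj[rr /opair_inj[pp FF]]].
have le_eeq x y : x ∈ P -> x ≈ y -> LE y x.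
  move=> xP xy; apply: (mem_eeql _ (stronger_refl xP)).
  by apply: opair_eeq; [exact: eeq_sym|exact: eeq_refl].
apply: fdead_step_mono h => //; [|exact: le_eeq|exact: le_eeq].
move=> r2 p2 F2 F3 r2P p2P F2M gF2 FF2 [b' [b'M [b'b k]]].
exists b'; split=> //; split; first exact: mem_eeqr bb b'b.
apply: mem_eeql k.
exact: code_eeq (eeq_sym FF2).
Qed.

Definition fdead_below (a r p F : Ens) : Prop :=
  exists b, b ∈ M /\ (b ∈ a /\ fdead b (opair r (opair p F))).

(** The recursion equation: approximations agree on common stages, and every stage of [M] lies in
    the domain of one. *)
Lemma fdeadE a r p F : a ∈ M -> r ∈ P -> p ∈ P -> F ∈ M -> name_rel F ->
  (fdead a (opair r (opair p F)) <-> fdead_step (fdead_below a) r p F).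
Proof.
move=> aM rP pP FM gF; split.
  move=> [f [fM [S [SM [fS [aS]]]]]].
  move=> /(proj1 (fS.2 a aM aS r (P_M rP) rP p (P_M pP) pP F FM gF)).
  apply: fdead_step_mono => //;
  [|exact: stronger_refl|exact: stronger_refl|exact: eeq_refl].
  move=> r1 p1 F1 F2 r1P p1P F1M gF1 FF [b' [b'M [b'b h]]].
  exists b'; split=> //; split=> //; exists f; split=> //; exists S; split=> //.
  split=> //; split.
    by have /(transitive_inP SM) k := fS.1; exact: k _ aS _ b'b.
  apply: mem_eeql h.
  exact: code_eeq (eeq_sym FF).
move=> h; have [f [S [fM SM fS aS]]] := approx_ex aM.
exists f; split=> //; exists S; split=> //; split=> //; split=> //.
apply: (proj2 (fS.2 a aM aS r (P_M rP) rP p (P_M pP) pP F FM gF)).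
apply: fdead_step_mono h => //;
  [|exact: stronger_refl|exact: stronger_refl|exact: eeq_refl].
move=> r1 p1 F1 F2 r1P p1P F1M gF1 FF [b' [b'M [b'a]]].
move=> [f' [f'M [S' [S'M [fS' [bS' h]]]]]].
exists b'; split=> //; split=> //.
apply: (@mem_eeql _ (opair b' (opair r1 (opair p1 F1)))).
  exact: code_eeq (eeq_sym FF).
apply: (approx_agree S'M SM fS' fS) h => //.
by have /(transitive_inP SM) k := fS.1; exact: k _ aS _ b'a.
Qed.

(** All states lie in one set of [M], so the least ordinal stages killing them are bounded in [M].
    Neither [y] nor [G] occurs here, so one [A] serves every [y]. *)
Lemma fdead_collection : exists A, [/\ A ∈ M, ord A &
  forall r p F a, r ∈ P -> p ∈ P -> F ∈ M -> name_rel F -> a ∈ M -> ord a ->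
  fdead a (opair r (opair p F)) -> fdead_below A r p F].
Proof.
have [C0 [C0M hC0]] := product_bound UM UM.
have [C1 [C1M hC1]] := M_power C0M.
have [C2 [C2M hC2]] := product_bound PM C1M.
have [C3 [C3M hC3]] := product_bound PM C2M.
have [|A [AM oA hA]] := ord_collection dfn_fdead _ C3M.
  by move=> a b x ab; apply: fdead_eeq => //; exact: eeq_refl.
exists A; split=> // r p F a rP pP FM gF aM oa h.
have [|b [bA bx]] := hA _ a _ aM oa h.
  apply: hC3 => //; apply: hC2 => //; apply/hC1; split=> // z zF.
  have [rho [_ [rU [sig [_ [sU ze]]]]]] := gF z (Mtr FM zF) zF.
  by apply: mem_eeql ze _; exact: hC0.
by exists b; split=> //; exact: Mtr bA.
Qed.

Lemma fdead_below_mono a r r' p p' F F' : a ∈ M -> F ∈ M -> name_rel F -> F' ∈ M ->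
  name_rel F' -> LE r' r -> LE p' p -> F ≈ F' ->
  fdead_below a r p F -> fdead_below a r' p' F'.
Proof.
move=> aM FM gF F'M gF' rr pp FF [b [bM [ba h]]]; exists b; split=> //; split=> //.
have [r'P rP] := stronger_dom rr; have [p'P pP] := stronger_dom pp.
apply/fdeadE => //; move/fdeadE: h => /(_ bM rP pP FM gF).
apply: fdead_step_mono => //.
move=> r1 p1 F1 F2 r1P p1P F1M gF1 FF1 [d [dM [db h]]].
exists d; split=> //; split=> //; apply: fdead_eeq h; first exact: eeq_refl.
exact: opair_eeq (eeq_refl _) (opair_eeq (eeq_refl _) FF1).
Qed.

(** * Killed states *)

Section Codes.
Context (C : countType) (mc : C -> C -> Prop).

(* In the state (p, h) one looks for a generic G containing the condition c p with
   (c s)[G] = val k for all (s, k) in h. The three clauses give up because of a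
   dense set of M, of an element of (c s)[G], or of an element of val k. *)
Definition kill_step (L : nat -> seq (nat * C) -> Prop) p h : Prop :=
  (exists d, dense_in P le (c d) /\ forall q e, LE (c q) (c p) -> c e ∈ c d ->
    LE (c q) (c e) -> L q h)
  \/ (exists sig k s p', [/\ (sig, k) \in h, opair (c s) (c p') ∈ c sig,
      LE (c p) (c p') & forall k', mc k' k -> forall q, LE (c q) (c p) ->
      L q ((s, k') :: h)])
  \/ (exists sig k k', [/\ (sig, k) \in h, mc k' k & forall s p',
      opair (c s) (c p') ∈ c sig -> forall q, LE (c q) (c p) ->
      LE (c q) (c p') -> L q ((s, k') :: h)]).

Lemma kill_step_mono (L L' : nat -> seq (nat * C) -> Prop) p h :
  (forall q h, L q h -> L' q h) -> kill_step L p h -> kill_step L' p h.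
Proof.
move=> LL [[d [dd hL]]|[[sig [k [s [p' [kh sp pp hL]]]]]|
  [sig [k [k' [kh kk hL]]]]]].
- by left; exists d; split=> // q e qp ed qe; apply: LL; exact: hL qe.
- right; left; exists sig, k, s, p'; split=> // k' kk q qp; apply: LL; exact: hL.
- right; right; exists sig, k, k'; split=> // s p' sp q qp qp'; apply: LL.
  exact: hL qp'.
Qed.

(** Stages are arbitrary sets, which makes the transfinite recursion structural. *)
Fixpoint dead (a : Ens) : nat -> seq (nat * C) -> Prop :=
  match a with mkEns A f => kill_step (fun p h => exists i : A, dead (f i) p h) end.

Lemma dead_eeq a a' p h : a ≈ a' -> dead a p h -> dead a' p h.
Proof.
elim: a a' p h => A f IH [B g] p h /= [fg _]; apply: kill_step_mono => q h' [i hi].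
by have [j ij] := fg i; exists j; exact: IH hi.
Qed.

Definition dead_below a p h : Prop := exists b, b ∈ a /\ dead b p h.

Lemma deadE a p h : dead a p h <-> kill_step (dead_below a) p h.
Proof.
case: a => A f /=; split; apply: kill_step_mono => q h'.
  by case=> i hi; exists (f i); split=> //; exact: (@mem_elt (mkEns f) i).
by case=> b [[i bi] hb]; exists i; exact: dead_eeq hb.
Qed.

Context (val : C -> Ens).
Hypothesis valP : forall z k, z ∈ val k <-> exists k', mc k' k /\ z ≈ val k'.

(** * Truth lemma for killed states along a generic filter *)

Section Generic.
Context (G : Ens).
Hypothesis Ggen : generic M P le G.

Lemma generic_P r : r ∈ G -> r ∈ P.
Proof. by case: Ggen => -[GP _ _ _] _; exact: GP. Qed.

Lemma generic_up r q : r ∈ G -> LE r q -> q ∈ G.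
Proof.
case: Ggen => -[_ _ up _] _ rG rq; apply: (up r) => //.
by have [] := stronger_dom rq.
Qed.

Lemma generic_ext r q : r ∈ G -> q ∈ G -> exists s, [/\ s ∈ G, LE s r & LE s q].
Proof. by case: Ggen => -[_ _ _ h] _; exact: h. Qed.

(** The conditions that extend one satisfying [X], or have no extension satisfying [X], form a dense
    set of [M], which [G] meets. *)
Lemma generic_dec (X : Ens -> Prop) : D (fun e => X (e 0)) ->
  (exists r, r ∈ G /\ X r) \/
  (exists r, r ∈ G /\ forall r', r' ∈ M -> LE r' r -> ~ X r').
Proof.
move=> dX.
pose Q r := (exists r1, r1 ∈ M /\ (LE r r1 /\ X r1)) \/
  (forall r', r' ∈ M -> LE r' r -> ~ X r').
have dQ : D (fun e => Q (e 0)).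
  by rewrite /Q; dfn; exact: (dfn_rename (fun n => n) dX).
have [E [EM hE]] := separation dQ PM.
have [|r [rG /hE[rP]]] := Ggen.2 E EM.
  split=> [r /hE[]//|p pP].
  case: (pselect (exists r, r ∈ M /\ (LE r p /\ X r))) => [[r [rM [rp Xr]]]|n].
    exists r; split=> //; apply/hE; have [rP _] := stronger_dom rp; split=> //.
    by left; exists r; split=> //; split=> //; exact: stronger_refl.
  exists p; split; last exact: stronger_refl.
  apply/hE; split=> //; right=> r rM rp Xr; apply: n; by exists r.
case=> [[r1 [r1M [rr1 Xr1]]]|h]; last by right; exists r.
by left; exists r1; split=> //; exact: generic_up rr1.
Qed.

Lemma generic_dense_below L r p F : D (fun e => L (e 0) p F) -> r ∈ G ->
  dense_below L r p F -> exists r', r' ∈ G /\ L r' p F.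
Proof.
move=> dL rG h; have [//|[r1 [r1G n]]] := generic_dec (X := fun r => L r p F) dL.
have [s [sG sr sr1]] := generic_ext rG r1G.
have [r2 [r2M [r2s Lr2]]] := h s (stronger_M (stronger_refl (generic_P sG))) sr.
by case: (n r2 r2M (stronger_trans r2s sr1)).
Qed.

Lemma generic_dense_fdead_below a r p F : a ∈ M -> p ∈ M -> F ∈ M -> r ∈ G ->
  dense_below (fdead_below a) r p F -> exists r', r' ∈ G /\ fdead_below a r' p F.
Proof.
move=> aM pM FM; apply: generic_dense_below; rewrite /fdead_below.
by dfn; apply: dfn_fdead; dfn.
Qed.

(** The value [val k], external to [M], is replaced by a name [rho] in [M] with [rho[G] = val k]. *)
Definition represents F (h : seq (nat * C)) : Prop :=
  (forall sig k, (sig, k) \in h ->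
    exists rho, opair rho (c sig) ∈ F /\ interp G rho ≈ val k) /\
  (forall rho sig, opair rho sig ∈ F ->
    exists n k, [/\ (n, k) \in h, sig ≈ c n & interp G rho ≈ val k]).

Lemma represents_cons F h rho s k : represents F h -> interp G rho ≈ val k ->
  represents (addel F (opair rho (c s))) ((s, k) :: h).
Proof.
move=> [n1 n2] rk; split=> [sig k'|r sig].
  rewrite inE => /orP[/eqP[-> ->]|/n1[r [rF rk']]].
    by exists rho; split=> //; apply/mem_addel; right; exact: eeq_refl.
  by exists r; split=> //; apply/mem_addel; left.
move=> /mem_addel[/n2[n [k' [kh sn rk']]]|/opair_inj[rr ss]].
  by exists n, k'; split=> //; rewrite inE kh orbT.
exists s, k; split=> //; first by rewrite inE eqxx.
exact: eeq_trans (interp_eeq G rr) rk.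
Qed.

Lemma interp_mem rho rho' r : r ∈ G -> opair rho' r ∈ rho ->
  interp G rho' ∈ interp G rho.
Proof.
by move=> rG rr; apply/interp_spec; exists rho', r; split=> //; exact: eeq_refl.
Qed.

Section TruthStep.
Context (a : Ens).
Hypothesis aM : a ∈ M.
Hypothesis IH : forall p F h, c p ∈ P -> F ∈ M -> name_rel F -> represents F h ->
  (dead_below a p h <-> exists r, r ∈ G /\ fdead_below a r (c p) F).

(** Some [r] in [G] satisfies a clause of the rule; evaluating names by [G] turns it into the same
    clause of [kill_step], and [IH] handles the earlier stages. *)
Lemma dead_of_forced p F h : c p ∈ P -> F ∈ M -> name_rel F -> represents F h ->
  (exists r, r ∈ G /\ fdead a (opair r (opair (c p) F))) -> dead a p h.
Proof.
move=> pP FM gF FH [r0 [r0G]].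
have pM := cM p.
move=> /fdeadE => /(_ aM (generic_P r0G) pP FM gF) h0.
have [|r [rG]] := generic_dense_below _ r0G h0.
  rewrite /fdead_rule /dense_below /fdead_below; dfn; apply: dfn_fdead; dfn.
have rM := P_M (generic_P rG).
move=> h1; apply/deadE; case: h1 => [h1|[|]].
(* The dense set for the first clause: conditions below [c p] whose killing is forced densely below
   [r], and conditions incompatible with [c p]. *)
- pose Q d := (LE d (c p) /\ dense_below (fdead_below a) r d F) \/
    (forall q, q ∈ M -> LE q (c p) -> ~ LE q d).
  have dQ : D (fun e => Q (e 0)).
    rewrite /Q /dense_below /fdead_below; dfn; apply: dfn_fdead; dfn.
  have [E [EM hE]] := separation dQ PM.
  have [d ed] := cS EM.
  left; exists d; split; first split.
  + by move=> z /(mem_eeqr (eeq_sym ed))/hE[].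
  + move=> q qP.
    case: (pselect (exists q', q' ∈ M /\ (LE q' q /\ LE q' (c p)))) =>
        [[q' [q'M [q'q q'p]]]|n].
      have [q1 [q1M [q1q' hq1]]] := h1 q' q'M q'p.
      exists q1; split; last exact: stronger_trans q1q' q'q.
      apply: (mem_eeqr ed); apply/hE; have [q1P _] := stronger_dom q1q'; split=> //.
      by left; split=> //; exact: stronger_trans q1q' q'p.
    exists q; split; last exact: stronger_refl.
    apply: (mem_eeqr ed); apply/hE; split=> //; right=> q' q'M q'p q'q.
    by apply: n; exists q'.
  + move=> q e qp /(mem_eeqr (eeq_sym ed))/hE[eP Qe] qe.
    case: Qe => [[ep he]|n]; last by case: (n (c q) (cM q) qp).
    have [r1 [r1G o1]] := generic_dense_fdead_below aM (cM e) FM rG he.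
    have [qP _] := stronger_dom qp.
    apply/(IH qP FM gF FH); exists r1; split=> //.
    apply: fdead_below_mono o1 => //; last exact: eeq_refl.
    exact: stronger_refl (generic_P r1G).
- move=> [rho [rhoM [sig [sigM [s [sM [p' [p'M [rsF [sp [pp' hr]]]]]]]]]]].
  have [rU sU] := name_rel_elt FM gF rsF.
  have [n [k [kh sn rk]]] := FH.2 _ _ rsF.
  have [s' ss'] := cS sM; have [q' pq'] := cS p'M.
  right; left; exists n, k, s', q'; split=> //.
  + apply: (mem_eeqr sn); apply: mem_eeql sp.
    by apply: opair_eeq; exact: eeq_sym.
  + apply: mem_eeql pp'; apply: opair_eeq; first exact: eeq_refl.
    exact: eeq_sym.
  + move=> k' kk q qp.
    have : val k' ∈ val k by apply/valP; exists k'; split=> //; exact: eeq_refl.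
    move=> /(mem_eeqr (eeq_sym rk))/interp_spec[rho' [r' [r'G rr' rk']]].
    have r'M := P_M (generic_P r'G).
    have rho'M : rho' ∈ M by exact: opair_mem_tr Mtr rhoM rr'.
    have rho'U : rho' ∈ U by exact: opair_mem_tr Utr rU rr'.
    have [r1 [r1G r1r r1r']] := generic_ext rG r'G.
    have [qP _] := stronger_dom qp.
    have := hr rho' rho'M r' r'M rr' r1 (P_M (generic_P r1G)) r1r r1r' (c q) (cM q) qp.
    move=> /(generic_dense_fdead_below aM (cM q) (M_addel FM (M_opair rho'M sM)) r1G).
    move=> [r2 [r2G o2]].
    have sU' : s ∈ U by exact: opair_mem_tr Utr sU sp.
    have sU2 : c s' ∈ U by exact: mem_eeql (eeq_sym ss') sU'.
    have FF : addel F (opair rho' s) ≈ addel F (opair rho' (c s')).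
      apply/eeqP => z; rewrite !mem_addel.
      by rewrite (eeq_congr (eeq_refl z) (opair_eeq (eeq_refl rho') ss')).
    have FM' : addel F (opair rho' (c s')) ∈ M.
      by apply: M_addel => //; exact: M_opair.
    have gF' := name_rel_addel gF rho'U sU2.
    apply/(IH qP FM' gF'); first exact: represents_cons FH (eeq_sym rk').
    exists r2; split=> //; apply: fdead_below_mono o2 => //.
    - by apply: M_addel => //; exact: M_opair.
    - exact: name_rel_addel.
    - exact: stronger_refl (generic_P r2G).
    - exact: stronger_refl.
- move=> [rho [rhoM [sig [sigM [rho' [rho'M [r' [r'M [rsF [rr' [ler hr]]]]]]]]]]].
  have [rU sU] := name_rel_elt FM gF rsF.
  have [n [k [kh sn rk]]] := FH.2 _ _ rsF.
  have r'G := generic_up rG ler.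
  have rho'U : rho' ∈ U by exact: opair_mem_tr Utr rU rr'.
  have /valP[k' [kk rk']] := mem_eeqr rk (interp_mem r'G rr').
  right; right; exists n, k, k'; split=> // s p' sp q qp qp'.
  have sp' := mem_eeqr (eeq_sym sn) sp.
  have [qP _] := stronger_dom qp.
  have sU' : c s ∈ U by exact: opair_mem_tr Utr sU sp'.
  have FM' : addel F (opair rho' (c s)) ∈ M.
    by apply: M_addel => //; exact: M_opair.
  have := hr (c s) (cM s) (c p') (cM p') sp' (c q) (cM q) qp qp'.
  move=> /(generic_dense_fdead_below aM (cM q) FM' rG) h2.
  apply/(IH qP FM' (name_rel_addel gF rho'U sU')) => //.
  exact: represents_cons FH rk'.
Qed.

(* In each of the three cases, X r says that r refutes an instance of the rule.
   No r in G does so; hence some r in G has no extension satisfying X, and below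
   it every instance holds densely. *)
Lemma forced_of_dead p F h : c p ∈ P -> F ∈ M -> name_rel F -> represents F h ->
  dead a p h -> exists r, r ∈ G /\ fdead a (opair r (opair (c p) F)).
Proof.
move=> pP FM gF FH /deadE ho; have pM := cM p.
suff [r [rG h0]] : exists r, r ∈ G /\ forall r', LE r' r ->
    fdead_rule (fdead_below a) r' (c p) F.
  exists r; split=> //; apply/fdeadE => //; first exact: generic_P.
  move=> r' r'M r'r; exists r'; split=> //; split; last exact: h0.
  by apply: stronger_refl; have [] := stronger_dom r'r.
have le_eeq x x' y y' : x ≈ x' -> y ≈ y' -> LE x y -> LE x' y'.
  by move=> xx yy; apply: mem_eeql; apply: opair_eeq; exact: eeq_sym.
(* An earlier killing is forced by some [r1] in [G]; a common extension of [r] and [r1] contradicts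
   that nothing below [r] forces it. *)
have noG q q' F1 F2 h' r : q ∈ P -> q ≈ c q' -> F1 ∈ M -> name_rel F1 -> F2 ∈ M ->
    name_rel F2 -> F2 ≈ F1 -> represents F2 h' -> dead_below a q' h' -> r ∈ G ->
    (forall r', r' ∈ M -> LE r' r -> ~ fdead_below a r' q F1) -> False.
  move=> qP qq F1M gF1 F2M gF2 FF F2h o rG n.
  have q'P : c q' ∈ P by exact: mem_eeql (eeq_sym qq) qP.
  have [r1 [r1G o1]] := (IH q'P F2M gF2 F2h).1 o.
  have [r2 [r2G r2r r21]] := generic_ext rG r1G.
  case: (n r2 (P_M (generic_P r2G)) r2r); apply: fdead_below_mono o1 => //.
  exact: le_eeq _ _ _ _ (eeq_refl _) qq (stronger_refl qP).
have dec (X : Ens -> Prop) : D (fun e => X (e 0)) -> (forall r, r ∈ G -> ~ X r) ->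
    exists r, r ∈ G /\ forall r', r' ∈ M -> LE r' r -> ~ X r'.
  by move=> dX nX; have [[r [rG Xr]]|//] := generic_dec dX; case: (nX r rG Xr).
have eM r r' : LE r' r -> r' ∈ M by move=> /stronger_dom[/P_M].
case: ho => [[d [[dP dd] hd]]|[[sig [k [s [p' [kh sp pp' hL]]]]]|
  [sig [k [k' [kh kk hL]]]]]].
- have dM := cM d.
  pose X r := exists q, q ∈ M /\ (LE q (c p) /\ ((exists e, e ∈ M /\
    (e ∈ c d /\ LE q e)) /\ forall r', r' ∈ M -> LE r' r -> ~ fdead_below a r' q F)).
  have dX : D (fun e => X (e 0)).
    by rewrite /X /fdead_below; dfn; apply: dfn_fdead; dfn.
  have [|r [rG nX]] := dec X dX.
    move=> r rG [q [qM [qp [[e [eM' [ed qe]]] n]]]].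
    have [q' qq] := cS qM; have [e' ee] := cS eM'; have [qP _] := stronger_dom qp.
    apply: (noG q q' F F h r) => //; first exact: eeq_refl.
    apply: (hd q' e' (le_eeq _ _ _ _ qq (eeq_refl _) qp)).
      exact: mem_eeql (eeq_sym ee) ed.
    exact: le_eeq _ _ _ _ qq ee qe.
  exists r; split=> // r' r'r; left=> q qM qp.
  have [qP _] := stronger_dom qp; have [e [ed eq]] := dd q qP.
  have [eP _] := stronger_dom eq.
  exists e; split; first exact: P_M.
  split=> // r2 r2M r2r'; apply: contrapT => n.
  apply: (nX r2 r2M (stronger_trans r2r' r'r)); exists e; split; first exact: P_M.
  split; first exact: stronger_trans eq qp.
  split; first by exists e; split; [exact: P_M|split=> //; exact: stronger_refl].
  by move=> r3 r3M r32 o3; apply: n; exists r3.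
- have [rho [rsF rk]] := FH.1 _ _ kh.
  have [rU sU] := name_rel_elt FM gF rsF; have rM := Mtr UM rU; have sM := cM s.
  have cU : c s ∈ U by exact: opair_mem_tr Utr sU sp.
  pose X r := exists rho', rho' ∈ M /\ exists r', r' ∈ M /\ (opair rho' r' ∈ rho /\
    (LE r r' /\ exists q, q ∈ M /\ (LE q (c p) /\ forall r3, r3 ∈ M -> LE r3 r ->
     ~ fdead_below a r3 q (addel F (opair rho' (c s)))))).
  have dX : D (fun e => X (e 0)).
    by rewrite /X /fdead_below; dfn; apply: dfn_fdead; dfn.
  have [|r [rG nX]] := dec X dX.
    move=> r rG [rho' [rho'M [r' [r'M [rr' [ler [q [qM [qp n]]]]]]]]].
    have [q' qq] := cS qM; have [qP _] := stronger_dom qp.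
    have rho'U : rho' ∈ U by exact: opair_mem_tr Utr rU rr'.
    have /valP[k' [kk rk']] := mem_eeqr rk (interp_mem (generic_up rG ler) rr').
    have F1M : addel F (opair rho' (c s)) ∈ M by apply: M_addel => //; exact: M_opair.
    have gF1 := name_rel_addel gF rho'U cU.
    apply: (noG q q' _ _ ((s, k') :: h) r _ qq F1M gF1 F1M gF1) => //.
    + exact: eeq_refl.
    + exact: represents_cons.
    + by apply: hL => //; exact: le_eeq _ _ _ _ qq (eeq_refl _) qp.
  exists r; split=> // r' r'r; right; left.
  exists rho; split=> //; exists (c sig); split=> //; exists (c s); split=> //.
  exists (c p'); split=> //; split=> //; split=> //; split=> //.
  move=> rho' rho'M r1 r1M rr1 r2 r2M r2r' r21 q qM qp r3 r3M r32.
  apply: contrapT => n.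
  apply: (nX r3 r3M (stronger_trans r32 (stronger_trans r2r' r'r))).
  exists rho'; split=> //; exists r1; split=> //; split=> //.
  split; first exact: stronger_trans r32 r21.
  exists q; split=> //; split=> // r4 r4M r43 o4; apply: n.
  by exists r4.
- have [rho [rsF rk]] := FH.1 _ _ kh; have sigM := cM sig.
  have [rU sU] := name_rel_elt FM gF rsF; have rM := Mtr UM rU.
  have : val k' ∈ val k by apply/valP; exists k'; split=> //; exact: eeq_refl.
  move=> /(mem_eeqr (eeq_sym rk))/interp_spec[rho' [r' [r'G rr' rk']]].
  have r'M := P_M (generic_P r'G).
  have rho'M : rho' ∈ M by exact: opair_mem_tr Mtr rM rr'.
  have rho'U : rho' ∈ U by exact: opair_mem_tr Utr rU rr'.
  pose X r := exists s, s ∈ M /\ exists p', p' ∈ M /\ (opair s p' ∈ c sig /\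
    exists q, q ∈ M /\ (LE q (c p) /\ (LE q p' /\ forall r3, r3 ∈ M -> LE r3 r ->
     ~ fdead_below a r3 q (addel F (opair rho' s))))).
  have dX : D (fun e => X (e 0)).
    by rewrite /X /fdead_below; dfn; apply: dfn_fdead; dfn.
  have [|r0 [r0G nX]] := dec X dX.
    move=> r rG [s [sM [p' [p'M [sp [q [qM [qp [qp' n]]]]]]]]].
    have [q' qq] := cS qM; have [qP _] := stronger_dom qp.
    have [s' ss] := cS sM; have [p1 pp] := cS p'M.
    have sU' : s ∈ U by exact: opair_mem_tr Utr sU sp.
    have cU : c s' ∈ U by exact: mem_eeql (eeq_sym ss) sU'.
    apply: (noG q q' (addel F (opair rho' s)) (addel F (opair rho' (c s')))
      ((s', k') :: h) r) => //.
    + by apply: M_addel => //; exact: M_opair.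
    + exact: name_rel_addel.
    + by apply: M_addel => //; exact: M_opair.
    + exact: name_rel_addel.
    + apply/eeqP => z; rewrite !mem_addel.
      by rewrite (eeq_congr (eeq_refl z) (opair_eeq (eeq_refl rho') ss)).
    + exact: represents_cons (eeq_sym rk').
    + apply: (hL s' p1).
      * by apply: mem_eeql sp; apply: opair_eeq; exact: eeq_sym.
      * exact: le_eeq _ _ _ _ qq (eeq_refl _) qp.
      * exact: le_eeq _ _ _ _ qq pp qp'.
  (* Below [r'] as well, since the third clause wants [r] to put [rho'] into [rho]. *)
  have [r [rG rr0 rler']] := generic_ext r0G r'G.
  exists r; split=> // r1 r1r; right; right.
  exists rho; split=> //; exists (c sig); split=> //; exists rho'; split=> //.
  exists r'; split=> //; split=> //; split=> //.
  split; first exact: stronger_trans r1r rler'.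
  move=> s sM p' p'M sp q qM qp qp' r2 r2M r21.
  apply: contrapT => n.
  apply: (nX r2 r2M (stronger_trans r21 (stronger_trans r1r rr0))).
  exists s; split=> //; exists p'; split=> //; split=> //.
  exists q; split=> //; split=> //; split=> // r3 r3M r32 o3; apply: n.
  by exists r3.
Qed.

End TruthStep.
Lemma truth a p F h : a ∈ M -> c p ∈ P -> F ∈ M -> name_rel F -> represents F h ->
  (dead a p h <-> exists r, r ∈ G /\ fdead a (opair r (opair (c p) F))).
Proof.
elim/mem_ind: a p F h => a IH p F h aM pP FM gF FH.
have IHb q F' h' : c q ∈ P -> F' ∈ M -> name_rel F' -> represents F' h' ->
    (dead_below a q h' <-> exists r, r ∈ G /\ fdead_below a r (c q) F').
  move=> qP F'M gF' F'h; split=> [[b [ba]]|[r [rG [b [bM [ba ob]]]]]].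
    have bM := Mtr aM ba.
    move=> /(IH b ba q F' h' bM qP F'M gF' F'h)[r [rG ob]].
    by exists r; split=> //; exists b.
  by exists b; split=> //; apply/(IH b ba q F' h' bM qP F'M gF' F'h); exists r.
by split; [exact: forced_of_dead|exact: dead_of_forced].
Qed.

(** ∈-induction on [a]: in each clause [G] itself supplies a move to another true state, through
    genericity or through an element of the common value, and that state would be killed earlier. *)
Lemma true_not_dead a p h : c p ∈ G ->
  (forall sig k, (sig, k) \in h -> interp G (c sig) ≈ val k) -> ~ dead a p h.
Proof.
elim/mem_ind: a p h => a IH p h pG hv /deadE.
have IHb q h' : c q ∈ G ->
    (forall sig k, (sig, k) \in h' -> interp G (c sig) ≈ val k) -> ~ dead_below a q h'.
  by move=> qG h'v [b [ba]]; exact: IH.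
have cons s k : interp G (c s) ≈ val k ->
    forall sig k', (sig, k') \in (s, k) :: h -> interp G (c sig) ≈ val k'.
  by move=> sk sig k'; rewrite inE => /orP[/eqP[-> ->]//|]; exact: hv.
move=> [[d [dd hd]]|[[sig [k [s [p' [kh sp pp' hL]]]]]|
  [sig [k [k' [kh kk hL]]]]]].
- have [e [eG ed]] := Ggen.2 _ (cM d) dd.
  have [q [qG qp qe]] := generic_ext pG eG.
  have [q' qq] := cS (P_M (generic_P qG)); have [e' ee] := cS (P_M (generic_P eG)).
  apply: (IHb q' h _ hv); first exact: mem_eeql (eeq_sym qq) qG.
  apply: (hd q' e').
  + apply: mem_eeql qp; apply: opair_eeq (eeq_refl _); exact: eeq_sym.
  + exact: mem_eeql (eeq_sym ee) ed.
  + by apply: mem_eeql qe; apply: opair_eeq; exact: eeq_sym.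
- have p'G := generic_up pG pp'.
  have /valP[k' [kk sk]] := mem_eeqr (hv _ _ kh) (interp_mem p'G sp).
  apply: (IHb p ((s, k') :: h)) => //; first exact: cons.
  by apply: hL => //; apply: stronger_refl; exact: generic_P.
- have : val k' ∈ val k by apply/valP; exists k'; split=> //; exact: eeq_refl.
  move=> /(mem_eeqr (eeq_sym (hv _ _ kh)))/interp_spec[s [r [rG sr ks]]].
  have sM := opair_mem_tr Mtr (cM sig) sr.
  have [s' ss] := cS sM; have [r' rr] := cS (P_M (generic_P rG)).
  have [q [qG qp qr]] := generic_ext pG rG.
  have [q' qq] := cS (P_M (generic_P qG)).
  apply: (IHb q' ((s', k') :: h)); first exact: mem_eeql (eeq_sym qq) qG.
    apply: cons; apply: eeq_trans (eeq_sym ks).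
    exact: interp_eeq (eeq_sym ss).
  apply: (hL s' r').
  + by apply: mem_eeql sr; apply: opair_eeq; exact: eeq_sym.
  + apply: mem_eeql qp; apply: opair_eeq (eeq_refl _); exact: eeq_sym.
  + by apply: mem_eeql qr; apply: opair_eeq; exact: eeq_sym.
Qed.

End Generic.

(** * Necessity: stabilization of the killing and a surviving initial state *)

Context (kA : C).

(** Codes found [n] membership steps below [kA]; their values make up the transitive closure of
    [val kA]. *)
Fixpoint reach (n : nat) (k : C) : Prop :=
  if n is m.+1 then exists k', reach m k' /\ mc k k' else k = kA.

Definition wf_state (h : seq (nat * C)) : Prop :=
  forall sig k, (sig, k) \in h -> c sig ∈ U /\ exists n, reach n k.

(** Stage [a] kills nothing new. Only well-formed states count, as these have counterparts in
    [M]. *)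
Definition closed (a : Ens) : Prop := forall p h, c p ∈ P -> wf_state h ->
  dead a p h -> dead_below a p h.

Context (t0 : nat).
Hypothesis t0U : c t0 ∈ U.

Section Necessity.
Context (G : Ens).
Hypothesis Ggen : generic M P le G.
Hypothesis Gt : interp G (c t0) ≈ val kA.

(** Every element of an interpreted name is named by an element of its transitive closure, so the
    names stay in [U]. *)
Lemma reach_named n k : reach n k -> exists rho, rho ∈ U /\ interp G rho ≈ val k.
Proof.
elim: n k => [|n IH] k /=; first by move=> ->; exists (c t0).
move=> [k' [/IH[rho [rU rk]] kk]].
have : val k ∈ val k' by apply/valP; exists k; split=> //; exact: eeq_refl.
move=> /(mem_eeqr (eeq_sym rk))/interp_spec[rho' [r [rG rr krho]]].
exists rho'; split; last exact: eeq_sym.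
exact: opair_mem_tr rr.
Qed.

Lemma wf_represents h : wf_state h ->
  exists F, [/\ F ∈ M, name_rel F & represents G F h].
Proof.
elim: h => [|[s k] h IH] hh.
  have [F [FM F0]] := M_empty; exists F; split=> //.
    by move=> z _ /F0.
  by split=> // rho sig /F0.
have [|F [FM gF Fh]] := IH.
  by move=> sig k' kh; apply: hh; rewrite inE kh orbT.
have [|sU [n /reach_named[rho [rU rk]]]] := hh s k; first by rewrite inE eqxx.
exists (addel F (opair rho (c s))); split.
- by apply: M_addel => //; apply: M_opair => //; exact: Mtr rU.
- exact: name_rel_addel.
- exact: represents_cons.
Qed.

(** The truth lemma turns killing at [A] into forced killing, the choice of [A] moves it to an
    earlier stage, and the truth lemma leads back. *)
Lemma closed_of_generic A : A ∈ M -> ord A ->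
  (forall r p F a, r ∈ P -> p ∈ P -> F ∈ M -> name_rel F -> a ∈ M -> ord a ->
    fdead a (opair r (opair p F)) -> fdead_below A r p F) -> closed A.
Proof.
move=> AM oA hA p h pP wh oAp; have [F [FM gF Fh]] := wf_represents wh.
have [r [rG orF]] := (truth Ggen AM pP FM gF Fh).1 oAp.
have [b [bM [bA ob]]] := hA r (c p) F A (generic_P Ggen rG) pP FM gF AM oA orF.
exists b; split=> //; apply/(truth Ggen bM pP FM gF Fh); by exists r.
Qed.

Lemma start_of_generic A : exists p, c p ∈ P /\ ~ dead_below A p [:: (t0, kA)].
Proof.
have [p pG] : exists p, p ∈ G by case: Ggen => -[].
have pM := P_M (generic_P Ggen pG); have [p' pp] := cS pM.
have p'G : c p' ∈ G by exact: mem_eeql (eeq_sym pp) pG.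
exists p'; split; first exact: generic_P p'G.
move=> [b [_]]; apply: (true_not_dead Ggen p'G).
by move=> sig k; rewrite inE => /eqP[-> ->].
Qed.

End Necessity.

(** * Building a generic filter from surviving states *)

Section Sufficiency.
Context (A : Ens) (p0 : nat).
Hypothesis clA : closed A.
Hypothesis p0P : c p0 ∈ P.
Hypothesis p0_live : ~ dead_below A p0 [:: (t0, kA)].

Definition state : Type := nat * seq (nat * C).
Definition live (x : state) : Prop :=
  [/\ c x.1 ∈ P, wf_state x.2 & ~ dead_below A x.1 x.2].

(** One summand per clause of [kill_step]: a set to meet if it is dense, an element of a name to
    match with a value, an element of a value to match with a name. *)
Definition task : Type := (nat + (nat * C) * (nat * nat) + (nat * C) * C)%type.

Definition done (w : task) (x x' : state) : Prop :=
  match w with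
  | inl (inl d) => dense_in P le (c d) ->
      exists e, c e ∈ c d /\ LE (c x'.1) (c e)
  | inl (inr ((sig, k), (s, p))) => (sig, k) \in x.2 ->
      opair (c s) (c p) ∈ c sig -> LE (c x.1) (c p) ->
      exists k', mc k' k /\ (s, k') \in x'.2
  | inr ((sig, k), k') => (sig, k) \in x.2 -> mc k' k -> exists s p,
      [/\ opair (c s) (c p) ∈ c sig, LE (c x'.1) (c p) & (s, k') \in x'.2]
  end.

Definition extends (x' x : state) : Prop :=
  LE (c x'.1) (c x.1) /\ {subset x.2 <= x'.2}.

Lemma wf_cons sig k s p k' h : wf_state h -> (sig, k) \in h -> mc k' k ->
  opair (c s) (c p) ∈ c sig -> wf_state ((s, k') :: h).
Proof.
move=> wh kh kk sp sig' k1; rewrite inE => /orP[/eqP[-> ->]|]; last exact: wh.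
have [sU [n rn]] := wh _ _ kh; split; first exact: opair_mem_tr sp.
by exists n.+1, k.
Qed.

(** Since [A] is closed, a live state fails [kill_step]; negating the clause that belongs to [w]
    yields the extension. *)
Lemma live_step w x : live x -> exists x', [/\ live x', extends x' x & done w x x'].
Proof.
case: x => p h [/= pP wh ndead].
have nG : ~ kill_step (dead_below A) p h by move=> /deadE /(clA pP wh).
have self : extends (p, h) (p, h) by split=> //; exact: stronger_refl.
have triv : (forall x', done w (p, h) x') ->
    exists x', [/\ live x', extends x' (p, h) & done w (p, h) x'].
  by move=> d; exists (p, h); split.
have sub v : {subset h <= v :: h} by move=> u uh; rewrite inE uh orbT.
case: w triv => [[d|[[sig k] [s p']]]|[[sig k] k']] /= triv.
- case: (pselect (dense_in P le (c d))) => [dd|nd]; last exact: triv.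
  have [q [e [qp ed qe nq]]] : exists q e, [/\ LE (c q) (c p), c e ∈ c d,
      LE (c q) (c e) & ~ dead_below A q h].
    apply: contrapT => n; apply: nG; left; exists d; split=> // q e qp ed qe.
    by apply: contrapT => nq; apply: n; exists q, e.
  exists (q, h); split; last by move=> _; exists e.
    by split=> //; have [] := stronger_dom qp.
  by split.
- case: (pselect [/\ (sig, k) \in h, opair (c s) (c p') ∈ c sig &
    LE (c p) (c p')]) => [[kh sp pp]|n]; last first.
    by apply: triv => x' kh sp pp; case: n.
  have [k' [q [kk qp nq]]] : exists k' q, [/\ mc k' k, LE (c q) (c p) &
      ~ dead_below A q ((s, k') :: h)].
    apply: contrapT => n; apply: nG; right; left; exists sig, k, s, p'.
    split=> // k' kk q qp.
    by apply: contrapT => nq; apply: n; exists k', q.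
  exists (q, (s, k') :: h); split.
  + split=> /=; [by have [] := stronger_dom qp|exact: wf_cons kh kk sp|exact: nq].
  + by split=> //; exact: sub.
  + by move=> _ _ _; exists k'; rewrite inE eqxx.
- case: (pselect ((sig, k) \in h /\ mc k' k)) => [[kh kk]|n]; last first.
    by apply: triv => x' kh kk; case: n.
  have [s [p' [q [sp qp qp' nq]]]] : exists s p' q, [/\
      opair (c s) (c p') ∈ c sig, LE (c q) (c p), LE (c q) (c p') &
      ~ dead_below A q ((s, k') :: h)].
    apply: contrapT => n; apply: nG; right; right; exists sig, k, k'.
    split=> // s p' sp q qp qp'.
    by apply: contrapT => nq; apply: n; exists s, p', q.
  exists (q, (s, k') :: h); split.
  + split=> /=; [by have [] := stronger_dom qp|exact: wf_cons kh kk sp|exact: nq].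
  + by split=> //; exact: sub.
  + by move=> _ _; exists s, p'; rewrite inE eqxx.
Qed.

Lemma live_start : live (p0, [:: (t0, kA)]).
Proof.
split=> // sig k; rewrite inE => /eqP[-> ->]; split=> //; by exists 0.
Qed.

(* Each task is scheduled at infinitely many stages: the exponent of 2 in n+1
   takes every value infinitely often. *)
Definition scheduled (n : nat) : option task := unpickle (logn 2 n.+1).

Lemma scheduledP w N : exists2 n, N <= n & scheduled n = Some w.
Proof.
(* Here [n + 1] is the power of 2 with exponent [pickle w] times the odd number 2N+1, which also
   ensures that [n] is at least [N]. *)
exists (2 ^ pickle w * N.*2.+1).-1.
  rewrite -ltnS prednK ?muln_gt0 ?expn_gt0 //.
  apply: leq_trans (leq_pmull _ _); last by rewrite expn_gt0.
  by rewrite ltnS -addnn leq_addr.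
rewrite /scheduled prednK ?muln_gt0 ?expn_gt0 // lognM ?expn_gt0 //.
rewrite pfactorK // logn_coprime ?addn0 ?pickleK //.
by rewrite coprime2n /= odd_double.
Qed.

Lemma live_run : exists x : nat -> state, [/\ x 0 = (p0, [:: (t0, kA)]),
  forall n, live (x n), forall n, extends (x n.+1) (x n) &
  forall n w, scheduled n = Some w -> done w (x n) (x n.+1)].
Proof.
(* Liveness is bundled into the type so that the choice function can be iterated. *)
pose next n (x : {x | live x}) (x' : {x | live x}) :=
  extends (sval x') (sval x) /\
  forall w, scheduled n = Some w -> done w (sval x) (sval x').
have [f hf] : {f : nat * {x | live x} -> {x | live x} &
    forall v, next v.1 v.2 (f v)}.
  apply: (@choice _ _ (fun v => next v.1 v.2)) => -[n [x lx]].
  case E : (scheduled n) => [w|].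
    have [x' [lx' xx dw]] := live_step w lx.
    by exists (exist _ x' lx'); split=> //= w'; rewrite E => -[<-].
  exists (exist _ x lx); split=> /= [|w]; last by rewrite E.
  by split=> //; apply: stronger_refl; case: lx.
pose g := fix g n := if n is m.+1 then f (m, g m) else exist _ _ live_start.
exists (fun n => sval (g n)); split=> // n.
- by case: (g n).
- by have [] := hf (n, g n).
- by move=> w; have [_] := hf (n, g n); apply.
Qed.

(** [G] is the upward closure of the conditions of the run. Tasks of the first kind make it generic;
    the other two give the two inclusions of [(c sig)[G] = val k], by ∈-induction on the value. *)
Lemma generic_of_live :
  exists G, generic M P le G /\ interp G (c t0) ≈ val kA.
Proof.
have [x [x0 lx ex dx]] := live_run.
have xP n : c (x n).1 ∈ P by case: (lx n).
have xle m n : m <= n -> LE (c (x n).1) (c (x m).1).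
  move=> /subnK <-; elim: (n - m) => [|i IH]; first exact: stronger_refl.
  exact: stronger_trans (ex _).1 IH.
have xsub m n : m <= n -> {subset (x m).2 <= (x n).2}.
  move=> /subnK <-; elim: (n - m) => [|i IH] // u /IH; exact: (ex _).2.
pose G := mkEns (fun i : {n | c n ∈ P /\ exists m, LE (c (x m).1) (c n)} =>
  c (sval i)).
have GP z : z ∈ G <-> z ∈ P /\ exists m, LE (c (x m).1) z.
  split=> [[[n [nP [m mn]]] /= zn]|[zP [m mz]]].
    split; first exact: mem_eeql zn nP.
    exists m; apply: mem_eeql mn; apply: opair_eeq zn; exact: eeq_refl.
  have [n zn] := cS (P_M zP).
  have h : c n ∈ P /\ exists m, LE (c (x m).1) (c n).
    split; first exact: mem_eeql (eeq_sym zn) zP.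
    exists m; apply: mem_eeql mz; apply: opair_eeq (eeq_sym zn); exact: eeq_refl.
  by exists (exist _ n h).
have xG n : c (x n).1 ∈ G by apply/GP; split=> //; exists n; exact: stronger_refl.
exists G; split; first split.
- split.
  + by move=> z /GP[].
  + by exists (c (x 0).1).
  + move=> p q /GP[_ [m mp]] qP pq; apply/GP; split=> //; exists m.
    exact: stronger_trans mp pq.
  + move=> p q /GP[_ [m mp]] /GP[_ [n nq]]; exists (c (x (maxn m n)).1); split=> //.
      exact: stronger_trans (xle _ _ (leq_maxl _ _)) mp.
    exact: stronger_trans (xle _ _ (leq_maxr _ _)) nq.
- move=> E EM [EP Ed]; have [d ed] := cS EM.
  have [n _ /dx] := scheduledP (inl (inl d)) 0.
  case=> [|e [eE xe]].
    split=> [z /(mem_eeqr (eeq_sym ed))/EP//|p /Ed[q [qE qp]]].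
    by exists q; split=> //; exact: mem_eeqr ed qE.
  exists (c e); split; last exact: mem_eeqr (eeq_sym ed) eE.
  by apply/GP; split; [have [] := stronger_dom xe|exists n.+1].
suff H v : forall k sig n, v ≈ val k -> (sig, k) \in (x n).2 ->
    interp G (c sig) ≈ val k.
  by apply: (H _ kA t0 0 (eeq_refl _)); rewrite x0 inE eqxx.
elim/mem_ind: v => v IH k sig n vk kn.
have IHk k' s m : mc k' k -> (s, k') \in (x m).2 -> interp G (c s) ≈ val k'.
  move=> kk; apply: (IH (val k')); last exact: eeq_refl.
  by apply: (mem_eeqr (eeq_sym vk)); apply/valP; exists k'; split=> //; exact: eeq_refl.
apply/eeqP => z; split.
- move=> /interp_spec[s [p [/GP[pP [m mp]] sp zs]]].
  have [s' ss] := cS (opair_mem_tr Mtr (cM sig) sp).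
  have [p' pp] := cS (P_M pP).
  (* The stage comes after [n], where the requirement is present, and after [m], where the condition
     is below [p]. *)
  have [i im /dx h] := scheduledP (inl (inr ((sig, k), (s', p')))) (maxn m n).
  have [||k' [kk sk]] := h (xsub _ _ (leq_trans (leq_maxr _ _) im) _ kn).
  + by apply: mem_eeql sp; apply: opair_eeq; exact: eeq_sym.
  + apply: stronger_trans (xle _ _ (leq_trans (leq_maxl _ _) im)) _.
    by apply: mem_eeql mp; apply: opair_eeq (eeq_sym pp); exact: eeq_refl.
  apply/valP; exists k'; split=> //; apply: eeq_trans zs _.
  apply: eeq_trans (interp_eeq G ss) _; exact: IHk sk.
- move=> /valP[k' [kk zk]].
  have [i im /dx h] := scheduledP (inr ((sig, k), k')) n.
  have [s [p [sp xp sk]]] := h (xsub _ _ im _ kn) kk.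
  apply/interp_spec; exists (c s), (c p); split=> //.
    by apply/GP; split; [have [] := stronger_dom xp|exists i.+1].
  exact: eeq_trans zk (eeq_sym (IHk _ _ _ kk sk)).
Qed.

End Sufficiency.

(** The right side speaks only of stages up to [A] and of states, hence is Borel in [y] when
    membership of codes is. *)
Lemma generic_iff A : A ∈ M -> ord A ->
  (forall r p F a, r ∈ P -> p ∈ P -> F ∈ M -> name_rel F -> a ∈ M -> ord a ->
    fdead a (opair r (opair p F)) -> fdead_below A r p F) ->
  ((exists G, generic M P le G /\ interp G (c t0) ≈ val kA) <->
   closed A /\ exists p, c p ∈ P /\ ~ dead_below A p [:: (t0, kA)]).
Proof.
move=> AM oA hA; split=> [[G [Gg Gt]]|[clA [p [pP np]]]].
  split; first exact: (closed_of_generic Gg Gt AM oA hA).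
  exact: (start_of_generic Gg Gt A).
exact: generic_of_live clA pP np.
Qed.
End Codes.

(** * Borel sets of reals *)

Section Borel_dead.
Context (C : countType) (mc : baire -> C -> C -> Prop).
Hypothesis mcB : forall k k', borelp (fun y => mc y k k').

Lemma borel_kill_step (L : baire -> nat -> seq (nat * C) -> Prop) p h :
  (forall q h, borelp (fun y => L y q h)) ->
  borelp (fun y => kill_step (mc y) (L y) p h).
Proof.
move=> LB; apply: borel_or; last apply: borel_or.
- apply: borel_ex => d; apply: borel_and; first exact: borel_const.
  apply: borel_all => q; apply: borel_all => e; do 3!apply: borel_imp (borel_const _) _.
  exact: LB.
- apply: (@borel_ext (fun y => exists sig k s p', ((sig, k) \in h /\
    opair (c s) (c p') ∈ c sig /\ LE (c p) (c p')) /\ forall k', mc y k' k ->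
    forall q, LE (c q) (c p) -> L y q ((s, k') :: h))).
    move=> y; split=> [[sig [k [s [p' [[a [b d]] e]]]]]|[sig [k [s [p' [a b d e]]]]]];
    by exists sig, k, s, p'; split.
  do 4!apply: borel_ex => ?; apply: borel_and; first exact: borel_const.
  apply: borel_all => k'; apply: borel_imp; first exact: mcB.
  by apply: borel_all => q; apply: borel_imp (borel_const _) _; exact: LB.
- apply: (@borel_ext (fun y => exists sig k k', ((sig, k) \in h /\ mc y k' k) /\
    forall s p', opair (c s) (c p') ∈ c sig -> forall q, LE (c q) (c p) ->
    LE (c q) (c p') -> L y q ((s, k') :: h))).
    move=> y; split=> [[sig [k [k' [[a b] d]]]]|[sig [k [k' [a b d]]]]];
    by exists sig, k, k'; split.
  do 3!apply: borel_ex => ?; apply: borel_and.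
    by apply: borel_and; [exact: borel_const|exact: mcB].
  do 2!apply: borel_all => ?; apply: borel_imp (borel_const _) _.
  apply: borel_all => q; do 2!apply: borel_imp (borel_const _) _; exact: LB.
Qed.

Lemma borel_dead_below_of a p h : a ∈ M ->
  (forall b p h, b ∈ a -> borelp (fun y => dead (mc y) b p h)) ->
  borelp (fun y => dead_below (mc y) a p h).
Proof.
move=> aM hB; apply: (@borel_ext (fun y => exists n, c n ∈ a /\ dead (mc y) (c n) p h)).
  move=> y; split=> [[n [na h1]]|[b [ba h1]]]; first by exists (c n).
  have [n bn] := cS (Mtr aM ba); exists n; split.
    exact: mem_eeql (eeq_sym bn) ba.
  exact: dead_eeq h1.
apply: borel_ex => n; case: (pselect (c n ∈ a)) => na.
  by apply: borel_and; [exact: borel_const|exact: hB].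
by apply: (@borel_ext (fun=> False)); [move=> y; split=> // -[]|exact: borel_const].
Qed.

(** ∈-induction on [a]: up to ≈ its elements are among the [c n], so each stage adds only countable
    unions and intersections. *)
Lemma borel_dead a p h : a ∈ M -> borelp (fun y => dead (mc y) a p h).
Proof.
elim/mem_ind: a p h => a IH p h aM.
apply: (@borel_ext (fun y => kill_step (mc y) (dead_below (mc y) a) p h)).
  by move=> y; rewrite deadE.
apply: borel_kill_step => q h'; apply: borel_dead_below_of => // b r h2 ba.
by apply: IH => //; exact: Mtr ba.
Qed.

Lemma borel_dead_below a p h : a ∈ M -> borelp (fun y => dead_below (mc y) a p h).
Proof.
move=> aM; apply: borel_dead_below_of => // b q h' ba.
by apply: borel_dead; exact: Mtr ba.
Qed.

Lemma borel_reach kA n k : borelp (fun y => reach (mc y) kA n k).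
Proof.
elim: n k => [|n IH] k /=; first exact: borel_const.
by apply: borel_ex => k'; apply: borel_and; [exact: IH|exact: mcB].
Qed.

Lemma borel_closed kA a : a ∈ M -> borelp (fun y => closed (mc y) kA a).
Proof.
move=> aM; apply: borel_all => p; apply: borel_all => h; apply: borel_imp (borel_const _) _.
apply: borel_imp; last by apply: borel_imp; [exact: borel_dead|exact: borel_dead_below].
apply: borel_all => sig; apply: borel_all => k; apply: borel_imp (borel_const _) _.
by apply: borel_and (borel_const _) _; apply: borel_ex => n; exact: borel_reach.
Qed.

End Borel_dead.

Lemma borel_generic (C : countType) (mc : baire -> C -> C -> Prop)
    (val : baire -> C -> Ens) (kA : C) (t : Ens) :
  (forall k k', borelp (fun y => mc y k k')) ->
  (forall y z k, z ∈ val y k <-> exists k', mc y k' k /\ z ≈ val y k') ->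
  t ∈ U ->
  borelp (fun y => exists G, generic M P le G /\ val y kA ≈ interp G t).
Proof.
(* [A] is fixed before [y], so a single Borel condition covers all [y]. *)
move=> mcB valP tU; have [A [AM oA hA]] := fdead_collection.
have [t0 tt] := cS (Mtr UM tU).
have t0U : c t0 ∈ U by exact: mem_eeql (eeq_sym tt) tU.
apply: (@borel_ext (fun y => closed (mc y) kA A /\
    exists p, c p ∈ P /\ ~ dead_below (mc y) A p [:: (t0, kA)])); last first.
  apply: borel_and; first exact: borel_closed.
  apply: borel_ex => p; apply: borel_and (borel_const _) _; apply: borel_not.
  exact: borel_dead_below.
move=> y; rewrite -(generic_iff (valP y) kA t0U AM oA hA).
split=> -[G [Gg Gt]]; exists G; split=> //.
  exact: eeq_trans (eeq_sym Gt) (interp_eeq G (eeq_sym tt)).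
exact: eeq_trans (interp_eeq G (eeq_sym tt)) (eeq_sym Gt).
Qed.

End Model.

(** * Coding the transitive closure of R_y by a countable type *)

(* Codes for the elements of the transitive closure of R_y: R_y itself, (y)_j, pairs
   (n, m), the sets {n, m}, and numerals. *)
Inductive code :=
  | CSet
  | CRow of nat
  | COpair of nat & nat
  | CUpair of nat & nat
  | CNum of nat.

Definition code_enc (k : code) : nat * (nat * nat) :=
  match k with
  | CSet => (0, (0, 0))
  | CRow j => (1, (j, 0))
  | COpair n m => (2, (n, m))
  | CUpair n m => (3, (n, m))
  | CNum n => (4, (n, 0))
  end.

Definition code_dec (v : nat * (nat * nat)) : code :=
  match v with
  | (0, _) => CSet
  | (1, (j, _)) => CRow j
  | (2, (n, m)) => COpair n m
  | (3, (n, m)) => CUpair n m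
  | (_, (n, _)) => CNum n
  end.

Lemma code_encK : cancel code_enc code_dec.
Proof. by case. Qed.

HB.instance Definition _ := Countable.copy code (can_type code_encK).

Definition code_val (y : baire) (k : code) : Ens :=
  match k with
  | CSet => ens_of_set (Rset y)
  | CRow j => ens_of_fun (row y j)
  | COpair n m => opair (enat n) (enat m)
  | CUpair n m => upair (enat n) (enat m)
  | CNum n => enat n
  end.

(** The singleton {n} inside a Kuratowski pair is coded by [CUpair n n], whence the two choices for
    [b]. Rows equal to row 0 are excluded as in R_y. *)
Definition code_mem (y : baire) (k' k : code) : Prop :=
  match k, k' with
  | CSet, CRow j => row y j <> row y 0
  | CRow j, COpair n m => row y j n = m
  | COpair n m, CUpair a b => a = n /\ (b = n \/ b = m)
  | CUpair n m, CNum a => a = n \/ a = m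
  | CNum n, CNum a => a < n
  | _, _ => False
  end.

Lemma mem_enat z n : z ∈ enat n <-> exists m, m < n /\ z ≈ enat m.
Proof.
elim: n => [|n IH] /=; first by split=> [[[]]|[m []]].
rewrite -[esucc _]/(addel _ _) mem_addel IH; split.
  case=> [[m [mn zm]]|zn]; last by exists n.
  by exists m; split=> //; exact: ltnW.
move=> [m [+ zm]]; rewrite ltnS leq_eqVlt => /orP[/eqP mn|mn].
  by right; rewrite -mn.
by left; exists m.
Qed.

Lemma code_valP y z k :
  z ∈ code_val y k <-> exists k', code_mem y k' k /\ z ≈ code_val y k'.
Proof.
split; case: k => [|j|n m|n m|n] /=.
- move=> [[x [[j _ jx] x0]] /= zx]; exists (CRow j); split=> /=; last by rewrite jx.
  by move=> j0; apply: x0; rewrite -jx.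
- by move=> [n /= zn]; exists (COpair n (row y j n)).
- by move=> [[]/= zn]; [exists (CUpair n n)|exists (CUpair n m)]; split=> //=;
    split=> //; [left|right].
- by move=> [[]/= zn]; [exists (CNum n)|exists (CNum m)]; split=> //=; [left|right].
- by move=> /mem_enat[m [mn zm]]; exists (CNum m).
- move=> [[|j|? ?|? ?|?] [/= j0 zj]] //.
  have Rj : Rset y (row y j) by split=> //; exists j.
  by exists (exist _ _ Rj).
- by move=> [[|?|n m|? ?|?] [/= h zn]] //; exists n; rewrite /= h.
- by move=> [[|?|? ?|a b|?] [/= h zn]] //; case: h zn => -> [->|->] ?;
    apply/mem_upair; [left|right].
- by move=> [[|?|? ?|? ?|a] [/= h zn]] //; case: h zn => -> ?;
    apply/mem_upair; [left|right].
- by move=> [[|?|? ?|? ?|a] [/= an za]] //; apply/mem_enat; exists a.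
Qed.

Lemma borel_eq_coord n m : borelp (fun y => y n = y m).
Proof.
apply: (@borel_ext (fun y => exists a, y n = a /\ y m = a)).
  by move=> y; split=> [[a [-> ->]]|->] //; exists (y m).
by apply: borel_ex => a; apply: borel_and; exact: borel_coord.
Qed.

Lemma borel_code_mem k k' : borelp (fun y => code_mem y k k').
Proof.
case: k' k => [|j|n m|n m|n] [|j'|n' m'|n' m'|n'] /=; try exact: borel_const.
- apply: borel_not; apply: (@borel_ext (fun y => forall n, row y j' n = row y 0 n)).
    by move=> y; split=> [h|-> //]; apply/funext.
  by apply: borel_all => n; exact: borel_eq_coord.
- exact: borel_coord.
Qed.

(** * Enumeration of the countable model and final assembly *)

Lemma countable_enum (N : Ens) : countable_set N -> (exists x, x ∈ N) ->
  exists c : nat -> Ens, (forall n, c n ∈ N) /\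
    forall x, x ∈ N -> exists n, x ≈ c n.
Proof.
move=> [s sN] [x0 x0N].
(* Values of [s] outside [N] are replaced by the default [x0]. *)
exists (fun n => if pselect (s n ∈ N) then s n else x0); split=> [n|x xN].
  by case: pselect.
have [n xn] := sN x xN; exists n.
by case: pselect => // -[]; exact: mem_eeql (eeq_sym xn) xN.
Qed.

Theorem theorem9p1 (M P le t : Ens)
  (hM : ctm M)
  (hPM : opair P le ∈ M)
  (hP : forcing_notion P le)
  (htM : t ∈ M)
  (ht : is_name P t)
  (hforce : forall p, p ∈ P -> forces M P le p (FSubBaire 0) (fun _ => t)) :
  Borel [set y : baire | exists G : Ens,
    generic M P le G /\ ens_of_set (Rset y) ≈ interp G t].
Proof.
have [ctM Mtr Mzfc] := hM.
have [c [cM cS]] := countable_enum ctM Mzfc.1.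
have [PM leM] := M_opairE Mtr hPM.
(* Being transitive and containing [t], [U] contains every name that can occur in a requirement. *)
have [U [UM Utr tU]] := transitive_closure cM cS Mtr Mzfc htM.
exact: (borel_generic cM cS Mtr Mzfc PM leM UM Utr hP CSet borel_code_mem
  code_valP tU).
Qed.
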